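(* For any $\gamma\ge1$, if $h=h_\gamma>0$ is such that $\mathsf{E}_\infty[\widetilde{S}_{K-M}(h_\gamma)]=\gamma$, then $\widetilde{T}_{K-M}(h_\gamma)\in\mathcal{C}_\gamma$. If $|\mathcal{B}|\ge M+1$, then as $\gamma\to\infty$ $$\mathcal{J}_{\mathcal{B}}\left[\widetilde{T}_{K-M}(h_\gamma)\right]\sim\frac{\log\gamma}{(|\mathcal{B}|-M)\,\mathcal{I}}.$$
   Context: Setting. There are $K$ sensors, indexed by $[K]=\{1,\ldots,K\}$; $\mathbb{N}=\{1,2,\ldots\}$; $M\ge 0$ is an integer with $M<K$. An arbitrary fixed subset $\mathcal{N}\subseteq[K]$ of size $|\mathcal{N}|=K-M$ consists of honest sensors; the remaining $M$ sensors are corrupt. $X_t^k$ is the observation of sensor $k$ at time $t\in\mathbb{N}$. $f,g$ are known densities with respect to a $\sigma$-finite measure $\lambda$, with $0<\mathcal{I}:=\int \log(g/f)\,g\,d\lambda<\infty$. The change occurs at a deterministic time $\nu\in\{0,1,\ldots\}$ in a subset $\mathcal{B}\subseteq\mathcal{N}$: the variables $X_t^k$, $k\in\mathcal{N}$, $t\in\mathbb{N}$, are independent, and $X_t^k$ has density $g$ if $k\in\mathcal{B}$ and $t>\nu$, and density $f$ otherwise. Adversary. A strategy is a family $\pi=\{\pi_t\}_{t\in\mathbb{N}}$ of deterministic Borel functions (which may depend on $\mathcal{N},\nu,\mathcal{B}$) such that the corrupt observations at time $t$ are $(X_t^k)_{k\notin\mathcal{N}}=\pi_t\big((X_s^j)_{j\in\mathcal{N},\,1\le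 s\le t}\big)$. $\mathsf{P}_\nu^{\mathcal{B},\pi}$ is the resulting probability measure, and $\mathsf{P}_\infty^{\pi}$ is the measure when no change ever occurs in the honest sensors; expectations are $\mathsf{E}_\nu^{\mathcal{B},\pi}$, $\mathsf{E}_\infty^\pi$. The superscript $\pi$ is dropped for quantities depending only on honest observations. Criteria. $\mathcal{F}_t=\sigma(X_s^k:1\le s\le t,\,k\in[K])$. A detection rule is an $\{\mathcal{F}_t\}$-stopping time $T$. $$\mathcal{J}_{\mathcal{B}}[T]=\sup_{\nu,\pi}\ \operatorname{ess\,sup}\ \mathsf{E}_\nu^{\mathcal{B},\pi}[(T-\nu)^+\mid\mathcal{F}_\nu],\qquad \mathcal{A}[T]=\inf_\pi \mathsf{E}_\infty^\pi[T],\qquad \mathcal{C}_\gamma=\{T:\mathcal{A}[T]\ge\gamma\}.$$ Low-Sum-CUSUM. $\ell_t^k=\log\big(g(X_t^k)/f(X_t^k)\big)$, $Y_0^k=0$, $Y_t^k=(Y_{t-1}^k+\ell_t^k)^+$ for $k\in[K]$. $Y_t^{(1)}\le\cdots\le Y_t^{(K)}$ are the ordered values over all sensors, and $W_t^{(1)}\le\cdots\le W_t^{(|\mathcal{N}|)}$ are the ordered values of $Y_t^k$ over the honest sensors $k\in\mathcal{N}$ only. $\widetilde{T}_L(h)=\inf\{t\in\mathbb{N}:\sum_{k=1}^L Y_t^{(k)}\ge h\}$ and $\widetilde{S}_L(h)=\inf\{t\in\mathbb{N}:\sum_{k=1}^L W_t^{(k)}\ge h\}$. $x\sim y$ means $x/y\to1$.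 *)

(* Defs.v *)
From HB Require Import structures.
From mathcomp Require Import all_boot all_order all_algebra finmap.
From mathcomp Require Import all_classical all_reals all_analysis.
From mathcomp Require Import measurable_realfun ess_sup_inf.

Set Implicit Arguments.
Unset Strict Implicit.
Unset Printing Implicit Defensive.

Import Order.TTheory GRing.Theory Num.Theory.
Import numFieldNormedType.Exports.

Local Open Scope classical_set_scope.
Local Open Scope ring_scope.
Local Open Scope ereal_scope.

(* [x t k] is the observation of sensor [k] at time [t]. Times start at 1: the
   entries [x 0 k] carry no meaning and enter none of the sigma-algebras
   [history] below. *)
Definition obs_path (K : nat) (E : Type) : Type := nat -> 'I_K -> E.

Section Observations.
Context {K : nat} {dE : measure_display} {E : measurableType dE}.
Implicit Types (A N : {set 'I_K}) (x y : obs_path K E).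

(* The sigma-algebra of the path space generated by the coordinates [(s, j)]
   with [1 <= s <= t] and [j \in A]; for [A = setT] this is F_t. *)
Definition history A (t : nat) : set (set (obs_path K E)) :=
  <<s [set C | exists s j (D : set E),
        [/\ (1 <= s <= t)%N, j \in A, measurable D &
            C = [set x | D (x s j)]]] >>.

(* [pi t x k] is the value reported at time [t] by the corrupt sensor [k] when
   the honest sensors have observed the entries [x s j], [j \in N]. The two
   conditions say that it is a measurable function of the finite family
   [(x s j)], [j \in N], [1 <= s <= t]; in particular the remaining entries of
   [x] are irrelevant. *)
Definition strategy N (pi : nat -> obs_path K E -> 'I_K -> E) : Prop :=
  forall (t : nat) (k : 'I_K), (1 <= t)%N -> k \notin N ->
    (forall x y, (forall s j, (1 <= s <= t)%N -> j \in N -> x s j = y s j) ->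
       pi t x k = pi t y k) /\
    (forall D : set E, measurable D -> history N t [set x | D (pi t x k)]).

(* The observations of all [K] sensors, given those of the honest ones. *)
Definition attacked N (pi : nat -> obs_path K E -> 'I_K -> E)
    (x : obs_path K E) : obs_path K E :=
  fun t k => if k \in N then x t k else pi t x k.

Definition stopping_time {R : realType} (T : obs_path K E -> \bar R) : Prop :=
  (forall x, T x = +oo \/ exists n : nat, T x = n%:R%:E) /\
  (forall t : nat, history [set: 'I_K]%SET t [set x | T x <= t%:R%:E]).

End Observations.

Section LowSumCusum.
Context {R : realType} {K : nat} {E : Type}.
Implicit Types (f g : E -> R) (A : {set 'I_K}) (x : obs_path K E).

(* log (g / f) with values in the extended reals: it is -oo where [g] vanishes
   and +oo where only [f] does. *)
Definition llr f g (e : E) : \bar R := lne ((g e)%:E / (f e)%:E).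

(* With the library's conventions +oo + -oo = -oo, so a statistic that is +oo
   returns to 0 at an increment -oo; such paths arise only from corrupt
   observations at points where [f] vanishes, up to a null event. *)
Fixpoint cusum f g x (t : nat) (k : 'I_K) : \bar R :=
  if t is s.+1 then Order.max (cusum f g x s k + llr f g (x s.+1 k)) 0 else 0.

(* The [i]-th smallest of the values [y k], [k \in A], for [1 <= i <= #|A|]. *)
Definition order_stat A (y : 'I_K -> \bar R) (i : nat) : \bar R :=
  nth 0 (sort <=%O [seq y k | k <- enum A]) i.-1.

Definition low_sum A (L : nat) (y : 'I_K -> \bar R) : \bar R :=
  \sum_(1 <= i < L.+1) order_stat A y i.

(* The infimum of the empty set is +oo. *)
Definition low_sum_time f g A (L : nat) (h : R) x : \bar R :=
  ereal_inf [set t%:R%:E | t in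
    [set t : nat | (1 <= t)%N /\ h%:E <= low_sum A L (cusum f g x t)]].

End LowSumCusum.

Section ProbabilisticNotions.
Context {R : realType} {d dE : measure_display}.
Context {Omega : measurableType d} {E : measurableType dE}.

Definition mutually_independent (P : probability Omega R) (I : choiceType)
    (D : set I) (Y : I -> Omega -> E) : Prop :=
  forall (J : {fset I}) (A : I -> set E),
    [set` J] `<=` D -> (forall i, measurable (A i)) ->
    P (\bigcap_(i in [set` J]) (Y i @^-1` A i)) =
    \prod_(i <- J) P (Y i @^-1` A i).

Definition prob_density (lambda : set E -> \bar R) (f : E -> R) : Prop :=
  [/\ measurable_fun [set: E] f, forall e, (0 <= f e)%R &
      \int[lambda]_e (f e)%:E = 1].

(* [Z] is a version of the conditional expectation of the nonnegative variable
   [Y] given the sub-sigma-algebra [F]. *)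
Definition is_cond_expectation (P : probability Omega R)
    (F : set (set Omega)) (Y Z : Omega -> \bar R) : Prop :=
  [/\ forall w, 0 <= Z w,
      forall D : set (\bar R), measurable D -> F (Z @^-1` D) &
      forall A, F A -> \int[P]_(w in A) Z w = \int[P]_(w in A) Y w].

End ProbabilisticNotions.

Section Detection.
Context {R : realType} {K : nat} {d dE : measure_display}.
Context {Omega : measurableType d} {E : measurableType dE}.
Implicit Types (N B : {set 'I_K}) (T : obs_path K E -> \bar R).

(* Under [P] the honest variables [X_t^k], [k \in N], [t >= 1], are independent
   and [X_t^k] has density [p t k]. The entries of [X] at corrupt sensors are
   unconstrained; they are overwritten by [attacked]. *)
Definition honest_law (lambda : set E -> \bar R) N (X : Omega -> obs_path K E)
    (p : nat -> 'I_K -> E -> R) (P : probability Omega R) : Prop :=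
  (forall t k, (1 <= t)%N -> k \in N -> forall D : set E, measurable D ->
     P [set w | D (X w t k)] = \int[lambda]_(e in D) (p t k e)%:E) /\
  mutually_independent P [set i : nat * 'I_K | (1 <= i.1)%N /\ i.2 \in N]
    (fun i w => X w i.1 i.2).

(* F_t seen on the underlying space: the events generated by the observations
   of all sensors up to time [t] under the strategy [pi]. *)
Definition observed_history N (X : Omega -> obs_path K E)
    (pi : nat -> obs_path K E -> 'I_K -> E) (t : nat) : set (set Omega) :=
  preimage_set_system setT (attacked N pi \o X) (history [set: 'I_K]%SET t).

(* [P nu] is the law of the honest sensors when the change occurs at [nu] (in a
   subset B that enters only through [P]). All versions of a conditional
   expectation have the same essential supremum. *)
Definition worst_delay N (X : Omega -> obs_path K E)
    (P : nat -> probability Omega R) T : \bar R :=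
  ereal_sup [set s | exists nu pi Z,
    [/\ strategy N pi,
        is_cond_expectation (P nu) (observed_history N X pi nu)
          (fun w => Order.max (T (attacked N pi (X w)) - nu%:R%:E) 0) Z &
        s = ess_sup (P nu) Z]].

Definition worst_false_alarm N (X : Omega -> obs_path K E)
    (Pinf : probability Omega R) T : \bar R :=
  ereal_inf [set \int[Pinf]_w T (attacked N pi (X w)) | pi in strategy N].

Definition admissible N (X : Omega -> obs_path K E)
    (Pinf : probability Omega R) (gamma : R) :
    set (obs_path K E -> \bar R) :=
  [set T | stopping_time T /\ gamma%:E <= worst_false_alarm N X Pinf T].

End Detection.

(* Main.v *)
Require Import Defs.
From HB Require Import structures.
From mathcomp Require Import all_boot all_order all_algebra finmap.
From mathcomp Require Import all_classical all_reals all_analysis.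
From mathcomp Require Import measurable_realfun ess_sup_inf.
From mathcomp Require Import zify ring lra.

Set Implicit Arguments.
Unset Strict Implicit.
Unset Printing Implicit Defensive.

Import Order.TTheory GRing.Theory Num.Theory.
Import numFieldNormedType.Exports.

Local Open Scope classical_set_scope.
Local Open Scope ring_scope.
Local Open Scope ereal_scope.

(** The alarm time is compared with the threshold from both sides, under the
    law without change and under the law with a change, and each of the four
    comparisons is asymptotically sharp.

    Write [L] for [#|B| - M] and [I] for the mean of the log-likelihood ratio
    under the density [g]. Whatever the corrupt sensors report, any [K - M]
    sensors contain at least [L] sensors of [B], and these have drift [I] after
    the change; so the low sum grows at least at rate [L * I] and the delay is at
    most about [h / (L * I)] ([worst_delay_upper]). Conversely, if the corrupt
    sensors always report a value with nonpositive log-likelihood ratio, their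
    statistics stay at zero, the low sum is bounded by the sum over the honest
    sensors other than [M] sensors of [B], and it grows at rate [L * I] only
    ([worst_delay_lower]).

    Without a change the sum over all honest sensors has, uniformly in time,
    exponential moments of orders [theta] arbitrarily close to one, because
    [expR (theta * llr)] has mean below one under [f]. Hence the calibration
    forces [h <= (1 + o(1)) * ln gamma] ([calibrated_threshold_upper]). On the
    other hand a single sensor climbs to [h] in about [h / I] observations with
    probability [expR (- (1 + o(1)) * h)], by a change of measure, and renewed
    attempts on disjoint blocks give [ln gamma <= (1 + o(1)) * h]
    ([calibrated_threshold_lower]). The two ratios multiply to the claim.

    Only a first moment of the log-likelihood ratio is available. Its negative
    part has an exponential moment under [g], as [g * expR (- llr) <= f], so the
    lower tails of the random walks are exponentially small
    ([exp_neg_llr_small], [walk_lower_tail]). The upper tail is controlled by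
    the mean: when the walk almost never falls below its mean line, there is no
    mass left for an excess ([walk_upper_tail]).

    Admissibility rests on monotonicity: the [K - M] lowest of all statistics
    sum to at most the [K - M] lowest honest ones, so corrupt sensors can only
    delay the alarm ([attacked_low_sum_time_ge]). *)

(** * Integration against a density *)

Section Density.
Context d {T : measurableType d} {R : realType}.
Variables (nu mu : {measure set T -> \bar R}) (p : T -> R).
Hypothesis mp : measurable_fun [set: T] p.
Hypothesis p0 : forall x, (0 <= p x)%R.
Hypothesis nuE : forall A, measurable A -> nu A = \int[mu]_(x in A) (p x)%:E.

Import HBNNSimple.

(** Both sides agree on indicator functions and pass to the limit along the
    approximation of [phi] by simple functions. *)
Lemma ge0_integral_density (phi : T -> \bar R) :
  measurable_fun [set: T] phi -> (forall x, 0 <= phi x) ->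
  \int[nu]_x phi x = \int[mu]_x (phi x * (p x)%:E).
Proof.
move=> mphi phi0.
have mpE : measurable_fun [set: T] (EFin \o p) by exact/measurable_EFinP.
pose h := nnsfun_approx measurableT mphi.
have hphi x : (EFin \o h n) x @[n --> \oo] --> phi x.
  by apply: cvg_nnsfun_approx.
have -> : \int[nu]_x phi x =
    lim (\int[nu]_x (EFin \o h n) x @[n --> \oo]).
  have fE x : setT x -> phi x = lim ((EFin \o h n) x @[n --> \oo]).
    by move=> _; apply/esym/cvg_lim => //; exact: hphi.
  under eq_integral => x /[!inE] /fE -> //.
  apply: monotone_convergence => //.
  - move=> n; apply/measurable_EFinP; exact/measurable_funP.
  - by move=> n x Ex //=; rewrite lee_fin.
  - by move=> x Ex a b ab; rewrite lee_fin; exact/lefP/nd_nnsfun_approx.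
have -> : \int[mu]_x (phi x * (p x)%:E) =
    lim (\int[mu]_x ((EFin \o h n) x * (p x)%:E) @[n --> \oo]).
  have fg x : setT x ->
      phi x * (p x)%:E = lim (((EFin \o h n) x * (p x)%:E) @[n --> \oo]).
    move=> _; apply/esym/cvg_lim => //.
    by apply: cvgeZr; [by []|exact: hphi].
  under eq_integral => x /[!inE] /fg -> //.
  apply: monotone_convergence => [//| | |].
  - move=> n; apply/emeasurable_funM => //.
    exact/measurable_EFinP.
  - by move=> n x Ex /=; rewrite mule_ge0 ?lee_fin.
  - move=> x Ex a b ab/=; rewrite lee_wpmul2r ?lee_fin//.
    exact/lefP/nd_nnsfun_approx.
suff suf n : \int[nu]_x (EFin \o h n) x =
    \int[mu]_x ((EFin \o h n) x * (p x)%:E).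
  by under eq_fun do rewrite suf.
transitivity (\int[nu]_x
   (\sum_(y \in range (h n)) (y * \1_(h n @^-1` [set y]) x)%:E)).
  by apply: eq_integral => t tE; rewrite /= fimfunE -fsumEFin.
have indich r : measurable_fun setT
    (fun x => (r * \1_(h n @^-1` [set r]) x)%:E).
  by apply: (measurable_comp measurableT) => //; exact: measurable_funM.
rewrite ge0_integral_fsum//; last by move=> m y Ey; exact: nnfun_muleindic_ge0.
transitivity (\int[mu]_x (\sum_(y \in range (h n))
    (y * \1_(h n @^-1` [set y]) x)%:E * (p x)%:E)); last first.
  apply: eq_integral => x _; rewrite -ge0_mule_fsuml => [|y]; last first.
    exact: nnfun_muleindic_ge0.
  by rewrite fsumEFin // -(fimfunE _ x).
rewrite ge0_integral_fsum//; last 2 first.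
  - by move=> y; apply: emeasurable_funM.
  - move=> m y Ey; apply: mule_ge0; last by rewrite lee_fin.
    exact: nnfun_muleindic_ge0.
apply: eq_fsbigr => r rhn.
have r0 : (0 <= r)%R.
  by move: rhn; rewrite inE => -[x _ <-]; exact: fun_ge0.
have mA : measurable (h n @^-1` [set r]).
  by rewrite -[X in measurable X]setTI; exact: measurable_funP.
have mI : measurable_fun setT (fun x => (\1_(h n @^-1` [set r]) x : R)%:E).
  exact/measurable_EFinP.
under [LHS]eq_integral do rewrite EFinM.
rewrite ge0_integralZl_EFin//.
rewrite integral_indic// setIT nuE// integral_mkcond.
under [RHS]eq_integral do rewrite EFinM -muleA.
rewrite ge0_integralZl_EFin//; last 2 first.
- by move=> x _; rewrite mule_ge0 ?lee_fin.
- exact: emeasurable_funM.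
congr (_ * _); apply: eq_integral => x _.
by rewrite /restrict indicE; case: ifP => /= xA; rewrite ?mul1e ?mul0e.
Qed.

End Density.

(** * Independence of generated sigma-algebras *)

Section Independence.
Context {R : realType} {d dE : measure_display}.
Context {Omega : measurableType d} {E : measurableType dE}.
Context {I : choiceType}.
Variable Y : I -> Omega -> E.

Definition coord_events (J : set I) : set (set Omega) :=
  [set C | exists i D, [/\ J i, measurable D & C = Y i @^-1` D]].

Definition cylinders (J : set I) : set (set Omega) :=
  [set C | exists (F : {fset I}) (A : I -> set E),
     [/\ [set` F] `<=` J, forall i, measurable (A i) &
         C = \bigcap_(i in [set` F]) (Y i @^-1` A i)]].

(** The generators used here are not stable under intersection; the finite
    intersections [cylinders] are, and generate the same sigma-algebra. *)
Lemma coord_events_cylinders J : coord_events J `<=` cylinders J.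
Proof.
move=> _ [i [D [Ji mD ->]]]; exists [fset i]%fset, (fun=> D); split=> //.
  by move=> j /=; rewrite inE => /eqP ->.
apply/seteqP; split => w /=.
  by move=> Dw j /=; rewrite inE => /eqP ->.
by apply => /=; rewrite inE.
Qed.

Lemma cylinders_setI J : setI_closed (cylinders J).
Proof.
move=> _ _ [F [A [FJ mA ->]]] [G [B [GJ mB ->]]].
(* Each of the two families restricts only the coordinates of its own index
   set. *)
pose C i := (if i \in F then A i else setT) `&`
            (if i \in G then B i else setT).
exists (F `|` G)%fset, C; split.
- by move=> i /=; rewrite inE => /orP[/FJ|/GJ].
- by move=> i; apply: measurableI; case: ifP.
apply/seteqP; split => w /=.
  by move=> [wF wG] i /= _; split; case: ifPn => // ii; [exact: wF|exact: wG].
move=> wC; split => i /= ii.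
  by have := wC i; rewrite /= inE ii/= => /(_ isT) [] /=; rewrite ii.
by have := wC i; rewrite /= inE ii orbT/= => /(_ isT) [] _ /=; rewrite ii.
Qed.

Lemma coord_events_sub_cylinders J :
  <<s coord_events J >> `<=` <<s cylinders J >>.
Proof. by apply: sub_sigma_algebra2; exact: coord_events_cylinders. Qed.

Variables (P : probability Omega R) (K : set I).
Hypothesis mY : forall i, K i -> measurable_fun [set: Omega] (Y i).
Hypothesis indepY : mutually_independent P K Y.

Lemma cylinders_measurable J : J `<=` K -> cylinders J `<=` measurable.
Proof.
move=> JK _ [F [A [FJ mA ->]]].
apply: fin_bigcap_measurable; first exact: finite_fset.
by move=> i /FJ/JK Ki; rewrite -[X in measurable X]setTI; exact: mY.
Qed.

Lemma coord_sigma_measurable J :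
  J `<=` K -> <<s coord_events J >> `<=` measurable.
Proof.
move=> JK; apply: smallest_sub; first exact: sigma_algebra_measurable.
exact: subset_trans (@coord_events_cylinders J) (cylinders_measurable JK).
Qed.

(** For fixed [V] both sides are finite measures in [U], so agreement on the
    stable family of cylinders suffices. *)
Let indep_extend J (V : set Omega) : J `<=` K -> measurable V ->
  (forall C, cylinders J C -> P (C `&` V) = P C * P V) ->
  forall U, <<s coord_events J >> U -> P (U `&` V) = P U * P V.
Proof.
move=> JK mV CV U sU.
pose r := NngNum (fine_ge0 (measure_ge0 P V)).
have rE : (r%:num)%:E = P V by rewrite /= fineK ?fin_num_measure.
suff -> : P (U `&` V) = mscale r P U by rewrite /mscale rE muleC.
apply: (@g_sigma_algebra_measure_unique _ R Omega (cylinders J)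
  (cylinders_measurable JK) (fun=> setT) _ _ (mrestr P mV) (mscale r P)
  (@cylinders_setI J) _ _ U (coord_events_sub_cylinders sU)).
- move=> _; exists fset0, (fun=> setT); split => //.
  by apply/seteqP; split=> w //= _ i; rewrite /= inE.
- by apply/seteqP; split=> w // _; exists 0%N.
- by move=> C cC; rewrite /= /mrestr /mscale rE muleC; exact: CV.
- by move=> _; rewrite /= /mrestr setTI -ge0_fin_numE ?fin_num_measure.
Qed.

(** Both families of cylinders are stable under intersection, so the product
    rule passes from them to the sigma-algebras, one factor at a time. *)
Lemma indep_sigma J1 J2 : J1 `<=` K -> J2 `<=` K -> J1 `&` J2 = set0 ->
  forall U V, <<s coord_events J1 >> U -> <<s coord_events J2 >> V ->
  P (U `&` V) = P U * P V.
Proof.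
move=> J1K J2K J12 U V sU sV.
have mU := coord_sigma_measurable J1K sU.
have mV := coord_sigma_measurable J2K sV.
apply: (indep_extend J1K mV) => // C1 cC1.
have mC1 := cylinders_measurable J1K cC1.
rewrite setIC muleC; apply: (indep_extend J2K mC1) => // C2 cC2.
move: cC1 cC2 => [F [A [FJ mA ->]]] [G [B [GJ mB ->]]].
have FG i : i \in F -> i \in G -> False.
  by move=> /FJ iF /GJ iG; have : set0 i by rewrite -J12.
pose C i := if i \in G then B i else A i.
have mC i : measurable (C i) by rewrite /C; case: ifP.
have cupE : \bigcap_(i in [set` (F `|` G)%fset]) (Y i @^-1` C i) =
   \bigcap_(i in [set` G]) (Y i @^-1` B i) `&`
   \bigcap_(i in [set` F]) (Y i @^-1` A i).
  apply/seteqP; split => w /=.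
    move=> wC; split => i /= ii.
      by have := wC i; rewrite /C /= inE ii orbT; apply.
    have := wC i; rewrite /C /= inE ii; case: ifPn => iG; last by apply.
    by have := FG _ ii iG.
  move=> [wG wF] i /=; rewrite inE /C; case: ifPn => iG.
    by move=> _; exact: (wG i iG).
  by rewrite ?orbF => iF; apply: (wF i); move: iF; rewrite /= ?(negbTE iG) ?orbF.
rewrite -cupE (indepY (J := (F `|` G)%fset))//; last first.
  by move=> i /=; rewrite inE => /orP[/FJ/J1K|/GJ/J2K].
rewrite (indepY (J := F)) //; last by move=> i /FJ/J1K.
rewrite (indepY (J := G)) //; last by move=> i /GJ/J2K.
rewrite (big_fsetID _ (mem G)) /=; congr (_ * _).
  apply: eq_fbig => [i|i]; rewrite !inE.
    by case: (i \in G); rewrite ?andbF ?orbT.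
  by rewrite /C => /andP[_]; case: ifP.
apply: eq_fbig => [i|i]; rewrite !inE; last first.
  by rewrite /C => /andP[_]; case: ifP.
case: (boolP (i \in G)) => iG; rewrite ?andbT ?andbF ?orbF//.
by apply/esym/negP => iF; exact: FG iF iG.
Qed.

End Independence.

Section CoordMeasurable.
Context {d dE dT : measure_display}.
Context {Omega : measurableType d} {E : measurableType dE}.
Context {T : measurableType dT} {I : choiceType}.
Implicit Types (Y : I -> Omega -> E) (J : set I).

Definition coord_measurable Y J (U : Omega -> T) : Prop :=
  forall A, measurable A -> <<s coord_events Y J >> (U @^-1` A).

Lemma coord_measurableP Y J (U : Omega -> T) :
  coord_measurable Y J U <->
  @measurable_fun _ _ (g_sigma_algebraType (coord_events Y J)) T setT U.
Proof.
split=> [h _ A mA|h A mA]; first by rewrite setTI; exact: h.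
by rewrite -[X in <<s _ >> X]setTI; exact: h.
Qed.

Lemma coord_measurableS Y J J' (U : Omega -> T) : J `<=` J' ->
  coord_measurable Y J U -> coord_measurable Y J' U.
Proof.
move=> JJ' h A mA; apply: sub_sigma_algebra2 (h A mA).
by move=> _ [i [D [Ji mD ->]]]; exists i, D; split=> //; exact: JJ'.
Qed.

Lemma measurable_fun_coord Y J i : J i ->
  @measurable_fun _ _ (g_sigma_algebraType (coord_events Y J)) E setT (Y i).
Proof.
move=> Ji _ A mA; rewrite setTI; apply: sub_sigma_algebra.
by exists i, A.
Qed.

End CoordMeasurable.

Lemma coord_measurable_comp {d dE d1 d2 : measure_display}
    {Omega : measurableType d} {E : measurableType dE}
    {T1 : measurableType d1} {T2 : measurableType d2} {I : choiceType}
    (Y : I -> Omega -> E) (J : set I) (phi : T1 -> T2) (U : Omega -> T1) :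
  measurable_fun [set: T1] phi -> coord_measurable Y J U ->
  coord_measurable Y J (fun w => phi (U w)).
Proof.
move=> mphi cU A mA; apply: (cU (phi @^-1` A)).
by rewrite -[X in measurable X]setTI; exact: mphi.
Qed.

Lemma measure_le_integral {R : realType} {d} {Omega : measurableType d}
    (P : {measure set Omega -> \bar R}) (A : set Omega)
    (phi : Omega -> \bar R) (c : R) :
  (0 <= c)%R -> measurable A -> measurable_fun [set: Omega] phi ->
  (forall w, 0 <= phi w) -> (forall w, A w -> c%:E <= phi w) ->
  c%:E * P A <= \int[P]_w phi w.
Proof.
move=> c0 mA mphi phi0 cA; rewrite -(integral_cst _ mA c%:E) integral_mkcond.
apply: ge0_le_integral => //.
- by move=> w _; rewrite /restrict; case: ifP; rewrite ?lee_fin.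
- by apply/(measurable_restrictT _ _).1 => //; exact: measurable_cst.
- move=> w _; rewrite /restrict; case: ifPn => // /set_mem; exact: cA.
Qed.

Lemma integral_cst_probability {R : realType} {d} {Omega : measurableType d}
    (P : probability Omega R) (c : \bar R) : \int[P]_w c = c.
Proof.
rewrite integral_cst// -[RHS]mule1; congr (_ * _).
exact: probability_setT.
Qed.

Section IndependentIntegrals.
Context {R : realType} {d dE : measure_display}.
Context {Omega : measurableType d} {E : measurableType dE}.
Variable P : probability Omega R.

(** The product rule on rectangles identifies the joint law with the product of
    the marginal laws; the claim is then Tonelli's theorem. *)
Lemma indep_integral {d1 d2} {T1 : measurableType d1} {T2 : measurableType d2}
    (U : Omega -> T1) (V : Omega -> T2) (phi : T1 * T2 -> \bar R) :
  measurable_fun [set: Omega] U -> measurable_fun [set: Omega] V ->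
  (forall A B, measurable A -> measurable B ->
    P ((U @^-1` A) `&` (V @^-1` B)) = P (U @^-1` A) * P (V @^-1` B)) ->
  measurable_fun [set: T1 * T2] phi -> (forall z, 0 <= phi z) ->
  \int[P]_w phi (U w, V w) = \int[P]_w \int[P]_w' phi (U w, V w').
Proof.
move=> mU mV UV mphi phi0.
pose mUV : measurable_fun [set: Omega] (fun w => (U w, V w)) :=
  measurable_fun_pair mU mV.
pose PU := @distribution _ _ _ _ _ P
  (HB.pack_for {mfun Omega >-> T1} U (isMeasurableFun.Build _ _ _ _ _ mU)).
pose PV := @distribution _ _ _ _ _ P
  (HB.pack_for {mfun Omega >-> T2} V (isMeasurableFun.Build _ _ _ _ _ mV)).
pose W : {mfun Omega >-> (T1 * T2)%type} :=
  HB.pack_for {mfun Omega >-> (T1 * T2)%type} (fun w => (U w, V w))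
    (isMeasurableFun.Build _ _ _ _ _ mUV).
pose PW := distribution P W.
have PWE X : measurable X -> (PU \x PV)%E X = PW X.
  apply: product_measure_unique => A B mA mB; exact: UV.
transitivity (\int[PW]_z phi z).
  by rewrite ge0_integral_distribution.
transitivity (\int[(PU \x PV)%E]_z phi z).
  by apply: eq_measure_integral => A mA _; exact: (esym (PWE _ mA)).
rewrite fubini_tonelli1// /fubini_F.
rewrite ge0_integral_distribution//; last 2 first.
- exact: measurable_fun_fubini_tonelli_F.
- by move=> x; exact: integral_ge0.
apply: eq_integral => w _ /=.
rewrite ge0_integral_distribution//.
exact: measurableT_comp.
Qed.

Lemma indep_integralM (U V : Omega -> \bar R) :
  measurable_fun [set: Omega] U -> measurable_fun [set: Omega] V ->
  (forall A B, measurable A -> measurable B ->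
    P ((U @^-1` A) `&` (V @^-1` B)) = P (U @^-1` A) * P (V @^-1` B)) ->
  (forall w, 0 <= U w) -> (forall w, 0 <= V w) ->
  \int[P]_w (U w * V w) = \int[P]_w U w * \int[P]_w V w.
Proof.
move=> mU mV UV U0 V0.
(* Absolute values make the product nonnegative on the whole plane. *)
transitivity (\int[P]_w (`|U w| * `|V w|)).
  by apply: eq_integral => w _; rewrite !gee0_abs.
pose phi (z : \bar R * \bar R) := `|z.1| * `|z.2|.
have mphi : measurable_fun setT phi.
  by apply: emeasurable_funM; apply: measurableT_comp.
have phi0 z : 0 <= phi z by rewrite mule_ge0.
rewrite (indep_integral mU mV UV mphi phi0) /phi.
under eq_integral => w _.
  rewrite /= gee0_abs// ge0_integralZl//; [|exact: measurableT_comp].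
  under eq_integral => w' _ do rewrite gee0_abs//.
  over.
by rewrite /= ge0_integralZr// integral_ge0.
Qed.

Context {I : choiceType} {Y : I -> Omega -> E} {K : set I}.
Hypothesis mY : forall i, K i -> measurable_fun [set: Omega] (Y i).
Hypothesis indepY : mutually_independent P K Y.

Lemma coord_measurable_fun {dT} {T : measurableType dT} J (U : Omega -> T) :
  J `<=` K -> coord_measurable Y J U -> measurable_fun [set: Omega] U.
Proof.
move=> JK h _ A mA; rewrite setTI.
by apply: (coord_sigma_measurable mY JK); exact: h.
Qed.

Lemma coord_indep_integral {d1 d2} {T1 : measurableType d1}
    {T2 : measurableType d2} J1 J2 (U : Omega -> T1) (V : Omega -> T2)
    (phi : T1 * T2 -> \bar R) :
  J1 `<=` K -> J2 `<=` K -> J1 `&` J2 = set0 ->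
  coord_measurable Y J1 U -> coord_measurable Y J2 V ->
  measurable_fun [set: T1 * T2] phi -> (forall z, 0 <= phi z) ->
  \int[P]_w phi (U w, V w) = \int[P]_w \int[P]_w' phi (U w, V w').
Proof.
move=> J1K J2K J12 cU cV; apply: indep_integral.
- exact: coord_measurable_fun cU.
- exact: coord_measurable_fun cV.
- by move=> A B mA mB; apply: (indep_sigma mY indepY J1K J2K J12); [exact: cU|exact: cV].
Qed.

Lemma coord_indep_integralM J1 J2 (U V : Omega -> \bar R) :
  J1 `<=` K -> J2 `<=` K -> J1 `&` J2 = set0 ->
  coord_measurable Y J1 U -> coord_measurable Y J2 V ->
  (forall w, 0 <= U w) -> (forall w, 0 <= V w) ->
  \int[P]_w (U w * V w) = \int[P]_w U w * \int[P]_w V w.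
Proof.
move=> J1K J2K J12 cU cV; apply: indep_integralM.
- exact: coord_measurable_fun cU.
- exact: coord_measurable_fun cV.
- by move=> A B mA mB; apply: (indep_sigma mY indepY J1K J2K J12); [exact: cU|exact: cV].
Qed.

End IndependentIntegrals.

(** * Log-likelihood ratios *)

Section ExpDifferenceQuotient.
Context {R : realType}.
Implicit Types (x y : R) (n : nat).
Local Open Scope ring_scope.

(** The difference quotient of [s |-> - expR (- s * x)] between [0] and
    [1 / n.+1]; its limit [x] turns exponential moments for small [s] into the
    mean. *)
Definition exp_quotient n x : R := (1 - expR (- (x / n.+1%:R))) * n.+1%:R.

Lemma exp_quotient_le n x : exp_quotient n x <= x.
Proof.
have n0 : 0 < n.+1%:R :> R by rewrite ltr0n.
rewrite /exp_quotient; set z := x / n.+1%:R.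
have -> : x = z * n.+1%:R by rewrite /z divfK// lt0r_neq0.
rewrite ler_pM2r//; have := expR_ge1Dx (- z); lra.
Qed.

Lemma bernoulli_ineq n y : 1 <= y -> (y - 1) * n%:R <= y ^+ n - 1.
Proof.
move=> y1; elim: n => [|n IH]; first by rewrite mulr0 expr0 subrr.
rewrite exprS -natr1.
have yn1 : 1 <= y ^+ n by rewrite exprn_ege1.
nra.
Qed.

(** This domination is integrable against [g] for [x] the log-likelihood ratio,
    since [g * expR (- x)] is then [f]. *)
Lemma exp_quotient_bound n x : `|exp_quotient n x| <= `|x| + expR (- x).
Proof.
have n0 : 0 < n.+1%:R :> R by rewrite ltr0n.
have ex0 := expR_ge0 (- x).
have [x0|x0] := leP 0 x.
  have q0 : 0 <= exp_quotient n x.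
    rewrite mulr_ge0 ?(ltW n0)// subr_ge0 expR_le1 oppr_le0.
    by rewrite divr_ge0 ?(ltW n0).
  by rewrite !ger0_norm//; have := exp_quotient_le n x; lra.
(* For negative [x] the quotient is minus [(y - 1) * n.+1], and [y ^+ n.+1] is
   [expR (- x)]. *)
pose y := expR (- (x / n.+1%:R)).
have y1 : 1 <= y.
  rewrite ltW// expR_gt1 oppr_gt0 pmulr_llt0// invr_gt0//.
have yE : y ^+ n.+1 = expR (- x).
  by rewrite -expRM_natl mulrN mulrCA divff ?mulr1// lt0r_neq0.
have := bernoulli_ineq n.+1 y1; rewrite yE => B.
have xx := normr_ge0 x.
rewrite ler_norml /exp_quotient -/y; apply/andP; split; nra.
Qed.

Lemma cvg_exp_quotient x : exp_quotient n x @[n --> \oo] --> x.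
Proof.
have h : x / n.+1%:R @[n --> \oo] --> 0.
  by rewrite -(mulr0 x); apply: cvgM; [exact: cvg_cst|exact: cvg_harmonic].
have h1 : x / (1 + x / n.+1%:R) @[n --> \oo] --> x.
  have {3}-> : x = x / (1 + 0) by rewrite addr0 divr1.
  apply: cvgM; first exact: cvg_cst.
  apply: cvgV; first by rewrite addr0 oner_eq0.
  by apply: cvgD => //; exact: cvg_cst.
apply: (squeeze_cvgr _ h1 (cvg_cst x)).
near=> n; rewrite exp_quotient_le andbT.
have n0 : 0 < n.+1%:R :> R by rewrite ltr0n.
have : `|0 - x / n.+1%:R| < 1.
  by near: n; move/cvgrPdist_lt: h => /(_ 1 ltr01).
rewrite sub0r normrN ltr_norml => /andP[y1 y2].
rewrite /exp_quotient.
set z := x / n.+1%:R in y1 y2 *.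
have -> : x = z * n.+1%:R by rewrite /z divfK// lt0r_neq0.
rewrite mulrAC ler_pM2r// expRN.
have z1 : 0 < 1 + z by lra.
have := expR_ge1Dx z => ez.
have : (expR z)^-1 <= (1 + z)^-1 by rewrite lef_pV2// ?posrE ?expR_gt0.
have : z / (1 + z) = 1 - (1 + z)^-1.
  by field; rewrite lt0r_neq0.
lra.
Unshelve. all: by end_near. Qed.

End ExpDifferenceQuotient.

Section DiscountedExp.
Context {R : realType}.
Implicit Types (s : R) (x y : \bar R).

(** The exponential of [- s * x], except at [+oo], where the value [+oo] in place
    of [0] keeps [exp_neg s] submultiplicative although [+oo + -oo = -oo]. *)
Definition exp_neg s x : \bar R :=
  if x == +oo then +oo else expeR ((- s)%:E * x).

Lemma exp_negN s : (0 < s)%R -> exp_neg s -oo = +oo.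
Proof.
by move=> s0; rewrite /exp_neg/= mulrNy sgrN gtr0_sg// EFinN mulN1e.
Qed.

Lemma exp_negE s (r : R) : exp_neg s r%:E = (expR (- (s * r)))%:E.
Proof. by rewrite /exp_neg/= mulNr. Qed.

Lemma exp_neg_ge0 s x : 0 <= exp_neg s x.
Proof. by rewrite /exp_neg; case: ifP => // _; exact: expeR_ge0. Qed.

Lemma exp_negD s x y : (0 < s)%R ->
  exp_neg s (x + y) <= exp_neg s x * exp_neg s y.
Proof.
move=> s0; have e0 (r : R) : 0 < exp_neg s r%:E.
  by rewrite exp_negE lte_fin expR_gt0.
have ey : exp_neg s +oo = +oo by [].
case: x => [x| |]; case: y => [y| |]; rewrite ?ey ?exp_negN//.
- by rewrite -EFinD !exp_negE -EFinM -expRD mulrDr opprD.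
all: by rewrite ?gt0_muley ?gt0_mulye ?leey.
Qed.

Lemma exp_neg_markov s x (a : R) : (0 < s)%R -> x <= a%:E ->
  (expR (- (s * a)))%:E <= exp_neg s x.
Proof.
move=> s0; case: x => [x| |]//; rewrite ?exp_negN ?leey//.
rewrite exp_negE !lee_fin => xa.
by rewrite ler_expR lerN2 ler_pM2l.
Qed.

End DiscountedExp.

Section LogLikelihoodRatio.
Context {R : realType} {dE : measure_display} {E : measurableType dE}.
Variables (lambda : {measure set E -> \bar R}) (f g : E -> R).
Hypotheses (densf : prob_density lambda f) (densg : prob_density lambda g).

Let mf : measurable_fun [set: E] f. Proof. by case: densf. Qed.
Let mg : measurable_fun [set: E] g. Proof. by case: densg. Qed.
Let f0 e : (0 <= f e)%R. Proof. by case: densf. Qed.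
Let g0 e : (0 <= g e)%R. Proof. by case: densg. Qed.
Let mfE : measurable_fun [set: E] (EFin \o f).
Proof. exact/measurable_EFinP. Qed.
Let mgE : measurable_fun [set: E] (EFin \o g).
Proof. exact/measurable_EFinP. Qed.

Lemma llrE e : llr f g e =
  if (g e <= 0)%R then -oo else
  if (f e <= 0)%R then +oo else (ln (g e) - ln (f e))%:E.
Proof.
rewrite /llr; have := f0 e; have := g0 e.
rewrite le_eqVlt => /predU1P[<-|gp].
  by move=> _; rewrite lexx mul0e le0_lneNy.
rewrite le_eqVlt => /predU1P[<-|fp].
  by rewrite (lt_geF gp) lexx inve0 gt0_muley ?lte_fin.
rewrite (lt_geF gp) (lt_geF fp).
have -> : (f e)%:E^-1 = ((f e)^-1)%:E by rewrite inver gt_eqF.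
by rewrite -EFinM lne_EFin ?divr_gt0// ln_div.
Qed.

Lemma measurable_llr : measurable_fun [set: E] (llr f g).
Proof.
have -> : llr f g = (fun e => if (g e <= 0)%R then -oo else
    if (f e <= 0)%R then +oo else (ln (g e) - ln (f e))%:E).
  by apply/funext => e; exact: llrE.
apply: measurable_fun_ifT => //.
  by apply: measurable_fun_ler => //; exact: measurable_cst.
apply: measurable_fun_ifT => //.
  by apply: measurable_fun_ler => //; exact: measurable_cst.
apply/measurable_EFinP; apply: measurable_funB.
  by apply: measurableT_comp => //; exact: measurable_ln.
by apply: measurableT_comp => //; exact: measurable_ln.
Qed.

Variable Ir : R.
Hypothesis defI : Ir%:E = \int[lambda]_e (llr f g e * (g e)%:E).

(** The integral defining [Ir] is finite and its negative part is at most
    [\int f], because [g * ln (f / g) <= f - g]; so its positive part is finite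
    too. *)
Lemma integrable_llr : lambda.-integrable [set: E] (fun e => llr f g e * (g e)%:E).
Proof.
set F := fun e => _.
have mF : measurable_fun [set: E] F.
  by apply: emeasurable_funM => //; exact: measurable_llr.
have Fneg : \int[lambda]_e F^\- e <= 1.
  have [_ _ <-] := densf; apply: ge0_le_integral => //.
  - exact: measurable_funeneg.
  - move=> e _; rewrite funenegE /F llrE; case: (leP (g e) 0%R) => ge.
      have -> : g e = 0%R by apply/eqP; rewrite eq_le ge g0.
      by rewrite mule0 oppe0 maxxx lee_fin.
    case: (leP (f e) 0%R) => fe; first by rewrite gt0_mulye ?lte_fin//= max_r ?lee_fin ?leNye.
    rewrite -EFinM -EFinN -EFin_max lee_fin ge_max f0 andbT.
    have fg0 : (0 < f e / g e)%R by rewrite divr_gt0.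
    have : (ln (f e / g e) <= f e / g e - 1)%R.
      have /= := @le_ln1Dx R (f e / g e - 1).
      have -> : (1 + (f e / g e - 1) = f e / g e)%R by rewrite addrC subrK.
      by apply; lra.
    rewrite ln_div ?posrE// -mulNr opprB => h.
    apply: le_trans (_ : (f e / g e - 1) * g e <= _)%R.
      by rewrite ler_pM2r.
    by rewrite mulrBl divfK ?gt_eqF// mul1r lerBlDr lerDl ltW.
apply/integrableP; split=> //.
have := defI; rewrite integralE => /esym IE.
have Fneg_fin : \int[lambda]_e F^\- e \is a fin_num.
  by rewrite ge0_fin_numE ?(le_lt_trans Fneg) ?ltry// integral_ge0.
have Fpos_fin : \int[lambda]_e F^\+ e \is a fin_num.
  have : Ir%:E \is a fin_num by [].
  by rewrite -IE fin_numB => /andP[].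
rewrite (_ : (fun e => `|F e|) = F^\+ \+ F^\-); last first.
  by rewrite -fune_abse.
rewrite ge0_integralD//; last 2 first.
- exact: measurable_funepos.
- exact: measurable_funeneg.
by apply: lte_add_pinfty; rewrite ltey_eq ?Fpos_fin ?Fneg_fin.
Qed.

(** The log-likelihood ratio is [+oo] where [f] vanishes and [g] does not, which
    integrability excludes. *)
Lemma dominated_density :
  {ae lambda, forall e, (f e <= 0)%R -> (g e <= 0)%R}.
Proof.
have := integrable_ae measurableT integrable_llr.
apply: filterS => e /(_ Logic.I); rewrite llrE => + fe.
by rewrite fe; case: (leP (g e)) => // ge; rewrite gt0_mulye ?lte_fin.
Qed.

Let measurable_eqe (c : \bar R) :
  measurable_fun [set: \bar R] (fun x : \bar R => x == c).
Proof.
apply: (measurable_fun_bool true); rewrite setTI.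
rewrite (_ : _ @^-1` _ = [set c]); first exact: emeasurable_set1.
by apply/seteqP; split=> x /= => [/eqP|->]; rewrite ?eqxx.
Qed.

Lemma measurable_expeR : measurable_fun [set: \bar R] (@expeR R).
Proof.
rewrite (_ : @expeR R = fun x => if x == +oo then +oo else
    if x == -oo then 0 else (expR (fine x))%:E); last first.
  by apply/funext => -[].
apply: measurable_fun_ifT => //; apply: measurable_fun_ifT => //.
apply/measurable_EFinP; apply: measurableT_comp => //.
Qed.

Lemma measurable_exp_neg s : measurable_fun [set: \bar R] (@exp_neg R s).
Proof.
apply: measurable_fun_ifT => //.
apply: measurableT_comp measurable_expeR _.
exact: measurable_funeM.
Qed.

(** Where [f] is positive, [expeR llr * f] is [g]; elsewhere [g] vanishes almost
    everywhere by [dominated_density]. *)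
Lemma integral_change_of_density (phi : \bar R -> \bar R) :
  measurable_fun [set: \bar R] phi -> (forall x, 0 <= phi x) ->
  \int[lambda]_e (phi (llr f g e) * expeR (llr f g e) * (f e)%:E) =
  \int[lambda]_e (phi (llr f g e) * (g e)%:E).
Proof.
move=> mphi phi0.
have mL := measurable_llr.
have mpl : measurable_fun [set: E] (fun e => phi (llr f g e)).
  exact: measurableT_comp.
apply: ge0_ae_eq_integral => //.
- apply: emeasurable_funM => //; apply: emeasurable_funM => //.
  exact: measurableT_comp measurable_expeR mL.
- exact: emeasurable_funM.
- by move=> e _; rewrite mule_ge0 ?lee_fin// mule_ge0// expeR_ge0.
- by move=> e _; rewrite mule_ge0 ?lee_fin.
- apply: filterS dominated_density => e fg _ /=; rewrite -muleA; congr (_ * _).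
  rewrite llrE; case: (leP (g e) 0%R) fg => // ge fg.
    by rewrite /= mul0e; congr EFin; apply/eqP; rewrite eq_le ge g0.
  case: (leP (f e) 0%R) fg => [fe /(_ isT)//|fe _ /=].
  by rewrite expRB !lnK ?posrE// -EFinM divfK// gt_eqF.
Qed.

(** Both integrands are [f `^ s * g `^ (1 - s)] where [f] and [g] are positive;
    this is how exponential moments before the change come from those after
    it. *)
Lemma integral_exp_llr_le s : (0 < s)%R -> (s < 1)%R ->
  \int[lambda]_e (expeR ((1 - s)%:E * llr f g e) * (f e)%:E) <=
  \int[lambda]_e (exp_neg s (llr f g e) * (g e)%:E).
Proof.
move=> s0 s1; have mL := measurable_llr.
apply: ge0_le_integral => //.
- by move=> e _; rewrite mule_ge0 ?lee_fin// expeR_ge0.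
- apply: emeasurable_funM => //.
  apply: measurableT_comp measurable_expeR _.
  exact: measurable_funeM.
- apply: emeasurable_funM => //.
  exact: measurableT_comp (measurable_exp_neg s) mL.
- move=> e _; rewrite llrE; case: (leP (g e) 0%R) => ge.
    have -> : g e = 0%R by apply/eqP; rewrite eq_le ge g0.
    by rewrite mulrNy gtr0_sg ?subr_gt0// mul1e mul0e mule0.
  case: (leP (f e) 0%R) => fe.
    have -> : f e = 0%R by apply/eqP; rewrite eq_le fe f0.
    by rewrite mule0 mule_ge0 ?exp_neg_ge0 ?lee_fin.
  rewrite exp_negE /= -!EFinM lee_fin mulrBl mul1r expRD expRB !lnK ?posrE//.
  by rewrite mulrAC divfK ?gt_eqF// mulrC.
Qed.

(** The derivative of the left-hand side at [s = 0] is [- Ir], by dominated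
    convergence of the difference quotients. *)
Lemma exp_neg_llr_small (eps s0 : R) : (0 < eps)%R -> (0 < s0)%R ->
  exists s, [/\ (0 < s)%R, (s < s0)%R &
    \int[lambda]_e (exp_neg s (llr f g e) * (g e)%:E) <=
    (expR (- (s * (Ir - eps))))%:E].
Proof.
move=> eps0 s00.
pose pos e := ~~ (f e <= 0)%R && ~~ (g e <= 0)%R.
pose x e := (ln (g e) - ln (f e))%R.
pose F n e := if pos e then (exp_quotient n (x e) * g e)%:E else 0.
pose L e := if pos e then (x e * g e)%:E else 0.
pose G e := `|llr f g e * (g e)%:E| + (f e)%:E.
have mpos : measurable_fun setT pos.
  apply: measurable_and; apply: measurable_neg;
    by apply: measurable_fun_ler => //; exact: measurable_cst.
have mx : measurable_fun setT x.
  by apply: measurable_funB; apply: measurableT_comp.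
have mexp n : measurable_fun setT (@exp_quotient R n).
  apply: measurable_funM; last exact: measurable_cst.
  apply: measurable_funB; first exact: measurable_cst.
  apply: measurableT_comp; first exact: measurable_funTS.
  apply: measurableT_comp => //.
  by apply: measurable_funM => //; exact: measurable_cst.
have mF n : measurable_fun setT (F n).
  apply: measurable_fun_ifT => //.
  apply/measurable_EFinP; apply: measurable_funM => //.
  exact: measurableT_comp.
have mL : measurable_fun setT L.
  apply: measurable_fun_ifT => //.
  by apply/measurable_EFinP; apply: measurable_funM.
have if_ : lambda.-integrable setT (EFin \o f).
  apply/integrableP; split=> //.
  under eq_integral do rewrite gee0_abs ?lee_fin//.
  by case: densf => _ _ ->; rewrite ltry.
have ig : lambda.-integrable setT (EFin \o g).
  apply/integrableP; split=> //.
  under eq_integral do rewrite gee0_abs ?lee_fin//.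
  by case: densg => _ _ ->; rewrite ltry.
have iG : lambda.-integrable setT G.
  by apply: integrableD => //; apply: integrable_abse; exact: integrable_llr.
have posE e : pos e -> [/\ (0 < f e)%R, (0 < g e)%R & llr f g e = (x e)%:E].
  rewrite /pos => /andP[fe ge].
  by rewrite llrE (negbTE fe) (negbTE ge) !ltNge; split.
have LE : \int[lambda]_e L e = Ir%:E.
  rewrite defI; apply: ae_eq_integral => //.
    by apply: emeasurable_funM => //; exact: measurable_llr.
  apply: filterS dominated_density => e fg _; rewrite /L.
  case: ifPn => [/posE[_ _ ->]//|]; rewrite /pos negb_and !negbK => npos.
  have ge : (g e <= 0)%R by case/orP: npos => // /fg.
  have -> : g e = 0%R by apply/eqP; rewrite eq_le ge g0.
  by rewrite mule0.
have FL e : F n e @[n --> \oo] --> L e.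
  rewrite /F /L; case: ifP => _; last exact: cvg_cst.
  apply: cvg_EFin; first exact: nearW.
  by apply: cvgM; [exact: cvg_exp_quotient|exact: cvg_cst].
have FG n e : `|F n e| <= G e.
  rewrite /F /G; case: ifPn => [/posE[fe ge ->]|_]; last first.
    by rewrite abse0 adde_ge0 ?lee_fin.
  rewrite -EFinM !abse_EFin -EFinD lee_fin !normrM !(ger0_norm (ltW ge)).
  have fE : f e = (expR (- x e) * g e)%R.
    by rewrite opprB expRB !lnK ?posrE// divfK// gt_eqF.
  by rewrite fE -mulrDl ler_pM2r// -normrM exp_quotient_bound.
have iF n : lambda.-integrable setT (F n).
  apply: le_integrable iG => // e _.
  by rewrite [leRHS]gee0_abs ?FG// /G adde_ge0 ?lee_fin.
have [_ _ cvI] : [/\ lambda.-integrable setT L,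
    [sequence \int[lambda]_e `|F n e - L e|]_n @ \oo --> 0 &
    [sequence \int[lambda]_e F n e]_n @ \oo --> \int[lambda]_e L e].
  apply: (dominated_convergence measurableT mF mL _ iG).
    by apply: aeW => e _; exact: FL.
  by apply: aeW => e n _; exact: FG.
have H1 := near_infty_natSinv_lt (PosNum s00).
have H2 : \forall n \near \oo, (Ir - eps)%:E < \int[lambda]_e F n e.
  apply: (cvI (fun y => (Ir - eps)%:E < y)); rewrite LE; apply: open_ereal_gt'.
  by rewrite lte_fin ltrBlDr ltrDl.
have [n _ /(_ n (leqnn n))[/= sn In]] := filterI H1 H2.
set s := (n.+1%:R^-1)%R in sn.
have s0_ : (0 < s)%R by rewrite invr_gt0.
exists s; split => //.
have -> : \int[lambda]_e (exp_neg s (llr f g e) * (g e)%:E) =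
    \int[lambda]_e ((g e)%:E - s%:E * F n e).
  apply: ae_eq_integral => //.
  - apply: emeasurable_funM => //.
    exact: measurableT_comp (measurable_exp_neg s) measurable_llr.
  - by apply: emeasurable_funB => //; exact: measurable_funeM.
  - apply: filterS dominated_density => e fg _; rewrite /F.
    case: ifPn => [/posE[_ _ ->]|].
      rewrite exp_negE -EFinM -EFinB; congr EFin.
      rewrite /exp_quotient -/s -[n.+1%:R]invrK -/s.
      rewrite [(s * x e)%R]mulrC; field.
      by rewrite gt_eqF.
    rewrite /pos negb_and !negbK => npos.
    have ge : (g e <= 0)%R by case/orP: npos => // /fg.
    have -> : g e = 0%R by apply/eqP; rewrite eq_le ge g0.
    by rewrite !mule0 sube0.
rewrite (integralB measurableT ig (integrableZl measurableT s (iF n))).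
rewrite integralZl//; case: densg => _ _ ->.
apply: (@le_trans _ _ (1 - s%:E * (Ir - eps)%:E)).
  by apply: leeB => //; rewrite lee_pmul2l ?lte_fin// ltW.
rewrite -EFinM -EFinB lee_fin.
by have := expR_ge1Dx (- (s * (Ir - eps)))%R.
Qed.

End LogLikelihoodRatio.

(** * Order statistics and the low-sum alarm time *)

Section LowSum.
Context {R : realType} {K : nat}.
Implicit Types (A B J : {set 'I_K}) (y : 'I_K -> \bar R) (L : nat).

Lemma low_sumE A L y : low_sum A L y =
  \sum_(i < L) nth 0 (sort <=%O [seq y k | k <- enum A]) i.
Proof.
rewrite /low_sum /order_stat big_add1 /= big_mkord.
by apply: eq_bigr => i _.
Qed.

(** The order statistics of a subfamily dominate those of the family. *)
Lemma nth_subseq_sorted d (T : porderType d) (x0 : T) (s t : seq T) i :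
  sorted <=%O s -> subseq t s -> (i < size t)%N -> (nth x0 s i <= nth x0 t i)%O.
Proof.
elim: s t i => [|a s IH] [|b t] i //= sas.
have ss : sorted <=%O s by exact: path_sorted sas.
have allas := order_path_min (@le_trans _ T) sas.
case: eqP => [->|_] sub; case: i => [|i] it //=.
- exact: IH.
- by apply: (allP allas); apply: (mem_subseq sub); rewrite mem_head.
- apply: le_trans (IH _ i.+1 ss sub it).
  have i1s : (i.+1 < size s)%N by rewrite (leq_trans it)// (size_subseq sub).
  rewrite (sorted_leq_nth (@le_trans _ T) (@lexx _ T) _ ss)// inE.
  exact: ltn_trans i1s.
Qed.

Lemma low_sum_le A J L y : J \subset A -> #|J| = L ->
  low_sum A L y <= \sum_(k in J) y k.
Proof.
move=> JA cJ; rewrite low_sumE.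
set s := sort _ _; pose t := sort <=%O [seq y k | k <- enum J].
have st : size t = L by rewrite size_sort size_map -cardE.
have ts : subseq t s.
  apply: subseq_sort; [exact: le_total|exact: le_trans|].
  apply: map_subseq.
  rewrite (_ : enum J = [seq k <- enum A | k \in J]) ?filter_subseq//.
  rewrite {1}/enum_mem -filter_predI; apply: eq_filter => k /=.
  by case: (boolP (k \in J)) => //= /(fintype.subsetP JA) ->.
have -> : \sum_(k in J) y k = \sum_(v <- t) v.
  rewrite -[LHS]big_enum -[LHS](big_map y xpredT id).
  by apply: perm_big; rewrite perm_sym perm_sort.
rewrite (big_nth 0) big_mkord st; apply: lee_sum => i _.
apply: nth_subseq_sorted => //; last by rewrite st.
exact: sort_le_sorted.
Qed.

Lemma low_sum_attained A L y : (L <= #|A|)%N ->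
  exists J, [/\ J \subset A, #|J| = L & low_sum A L y = \sum_(k in J) y k].
Proof.
move=> LA; pose r := sort (relpre y <=%O) (enum A).
have ur : uniq (take L r).
  by apply: take_uniq; rewrite sort_uniq enum_uniq.
have sr : size r = #|A| by rewrite size_sort -cardE.
have st : size (take L r) = L by rewrite size_takel// sr.
exists [set k in take L r]; split.
- apply/fintype.subsetP => k; rewrite inE => /mem_take.
  by rewrite mem_sort mem_enum.
- by rewrite cardsE -[RHS]st; exact/card_uniqP.
rewrite low_sumE sort_map -/r.
transitivity (\sum_(k <- take L r) y k); last first.
  rewrite big_uniq//=; apply: eq_bigl => k; by rewrite inE.
rewrite -(big_map y xpredT id) (big_nth 0) big_mkord size_map st.
by apply: eq_bigr => i _; rewrite map_take nth_take.
Qed.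

(** The low sum is the minimum of the sums over the [L]-element subsets, a form
    in which it is visibly measurable and monotone. *)
Lemma low_sum_geP A L y (h : \bar R) : (L <= #|A|)%N ->
  (h <= low_sum A L y) <->
  (forall J, J \subset A -> #|J| = L -> h <= \sum_(k in J) y k).
Proof.
move=> LA; split=> [hl J JA cJ|hJ].
  exact: le_trans hl (low_sum_le y JA cJ).
have [J [JA cJ ->]] := low_sum_attained y LA.
exact: hJ.
Qed.

Lemma low_sum_full A y : low_sum A #|A| y = \sum_(k in A) y k.
Proof.
have [J [JA cJ ->]] := low_sum_attained y (leqnn #|A|).
have /eqP -> // : J == A by rewrite eqEcard JA cJ leqnn.
Qed.

Lemma low_sumS A A' L y : A \subset A' -> (L <= #|A|)%N ->
  low_sum A' L y <= low_sum A L y.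
Proof.
move=> AA' LA; have [J [JA cJ ->]] := low_sum_attained y LA.
by apply: low_sum_le => //; exact: fintype.subset_trans JA AA'.
Qed.

(** Among any [#|A| - M] sensors at least [#|B| - M] belong to [B]. *)
Lemma low_sum_ge_common A B M y (c : R) : B \subset A -> (M <= #|B|)%N ->
  (0 <= c)%R -> (forall k, 0 <= y k) -> (forall k, k \in B -> c%:E <= y k) ->
  ((#|B| - M)%:R * c)%:E <= low_sum A (#|A| - M) y.
Proof.
move=> BA MB c0 y0 yB.
have [J [JA cJ ->]] := low_sum_attained y (leq_subr M #|A|).
have cJB : (#|B| - M <= #|J :&: B|)%N.
  have : (#|J :|: B| <= #|A|)%N by rewrite subset_leq_card// finset.subUset JA.
  rewrite cardsU cJ; have MA := leq_trans MB (subset_leq_card BA).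
  have : (#|J :&: B| <= #|B|)%N by rewrite subset_leq_card// finset.subsetIr.
  by move: (#|J :&: B|) (#|B|) (#|A|) MA MB => p q r; lia.
apply: (@le_trans _ _ (\sum_(k in J :&: B) y k)).
  apply: (@le_trans _ _ (\sum_(k in J :&: B) c%:E)).
    by rewrite sumEFin sumr_const lee_fin -[leRHS]mulr_natl ler_wpM2r// ler_nat.
  by apply: lee_sum => k; rewrite inE => /andP[_ kB]; exact: yB.
rewrite [leRHS](bigID (mem B)) /=.
rewrite (eq_bigl (fun k => (k \in J) && (k \in B))); last first.
  by move=> k; rewrite inE.
by rewrite leeDl// sume_ge0.
Qed.

End LowSum.

Section Walk.
Context {R : realType} {K : nat} {E : Type}.
Variables f g : E -> R.
Implicit Types (x : obs_path K E) (k : 'I_K) (a m n t : nat).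

(** The increments are those of the times [a + 1], ..., [a + m]. *)
Definition walk x a m k : \bar R := \sum_(i < m) llr f g (x (a + i).+1 k).

Lemma walk0 x a k : walk x a 0 k = 0.
Proof. by rewrite /walk big_ord0. Qed.

Lemma walkS x a m k :
  walk x a m.+1 k = walk x a m k + llr f g (x (a + m).+1 k).
Proof. by rewrite /walk big_ord_recr. Qed.

Lemma walkD x a m n k : walk x a (m + n) k = walk x a m k + walk x (a + m) n k.
Proof.
elim: n => [|n IH]; first by rewrite addn0 walk0 adde0.
by rewrite addnS !walkS IH addeA addnA.
Qed.

Lemma cusum_ge0 x t k : 0 <= cusum f g x t k.
Proof. by case: t => [|t] //=; rewrite le_max lexx orbT. Qed.

Lemma walk_le_cusum x a m k : walk x a m k <= cusum f g x (a + m) k.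
Proof.
elim: m => [|m IH]; first by rewrite walk0 cusum_ge0.
by rewrite walkS addnS /= le_max leeD.
Qed.

(** The first hypothesis bounds the running minimum of the walk, which the CUSUM
    subtracts; the second one bounds what is lost between [t] and [n]. *)
Lemma cusum_le_walk x n k (c : R) :
  (forall t, (t <= n)%N -> (- c)%:E <= walk x 0 t k) ->
  (forall t, (t <= n)%N -> (- c)%:E <= walk x t (n - t) k) ->
  forall t, (t <= n)%N -> cusum f g x t k <= walk x 0 n k + (c + c)%:E.
Proof.
move=> h1 h2.
have le1 t : (t <= n)%N -> cusum f g x t k <= walk x 0 t k + c%:E.
  have shift s : (s <= n)%N -> 0 <= walk x 0 s k + c%:E.
    by move=> sn; rewrite -leeBlDr// sub0e; exact: h1.
  elim: t => [|t IH] tn /=; first exact: shift.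
  rewrite ge_max shift// andbT walkS add0n -addeA [_ + c%:E]addeC addeA.
  by rewrite leeD2r// IH// ltnW.
move=> t tn; apply: le_trans (le1 t tn) _.
rewrite EFinD addeA leeD2r// -[X in _ <= walk x 0 X k + _](subnKC tn) walkD add0n.
rewrite -addeA -[leLHS]adde0 leeD2l//.
by rewrite -leeBlDr// sub0e; exact: h2.
Qed.

Lemma eq_cusum x x' n k :
  (forall t, (0 < t <= n)%N -> x t k = x' t k) ->
  cusum f g x n k = cusum f g x' n k.
Proof.
elim: n => [//|n IH] xx' /=; rewrite xx' ?leqnn// IH// => t /andP[t0 tn].
by rewrite xx'// t0 ltnW.
Qed.

Lemma cusum_eq0 x n k :
  (forall t, (0 < t <= n)%N -> llr f g (x t k) <= 0) ->
  cusum f g x n k = 0.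
Proof.
elim: n => [//|n IH] h /=; rewrite IH; last first.
  by move=> t /andP[t0 tn]; rewrite h// t0 ltnW.
by rewrite add0e max_r// h/=.
Qed.

End Walk.

Section LowSumTime.
Context {R : realType} {K : nat} {E : Type}.
Variables (f g : E -> R) (A : {set 'I_K}) (L : nat) (h : R).
Implicit Types (x : obs_path K E) (t : nat).
Local Notation T := (low_sum_time f g A L h).

Lemma low_sum_time_leP x t : (T x <= t%:R%:E) <->
  exists2 s, (0 < s <= t)%N & h%:E <= low_sum A L (cusum f g x s).
Proof.
split=> [|[s /andP[s0 st] hs]]; last first.
  apply: (@le_trans _ _ s%:R%:E); last by rewrite lee_fin ler_nat.
  by apply: ereal_inf_lbound; exists s.
move=> Tt; have : T x < t.+1%:R%:E.
  by rewrite (le_lt_trans Tt)// lte_fin ltr_nat.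
move=> /ereal_inf_lt[_ [s [s0 hs] <-]]; rewrite lte_fin ltr_nat ltnS => st.
by exists s => //; rewrite s0.
Qed.

Lemma low_sum_time_natP x : T x = +oo \/ exists n : nat, T x = n%:R%:E.
Proof.
pose Q t := (0 < t)%N && (h%:E <= low_sum A L (cusum f g x t)).
have [[t Qt]|nQ] := pselect (exists t, Q t).
  right; exists (ex_minn (ex_intro _ t Qt)); case: ex_minnP => n /andP[n0 hn] nmin.
  apply/eqP; rewrite eq_le; apply/andP; split.
    by apply: ereal_inf_lbound; exists n.
  apply: le_ereal_inf_tmp => _ [s [s0 hs] <-]; rewrite lee_fin ler_nat.
  by apply: nmin; rewrite /Q s0.
left; rewrite /low_sum_time (_ : [set _ | _] = set0) ?image_set0 ?ereal_inf0//.
apply/seteqP; split=> t //= [t0 ht]; apply: nQ; exists t.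
by rewrite /Q t0.
Qed.

Lemma low_sum_time_ge0 x : 0 <= T x.
Proof. by apply: le_ereal_inf_tmp => _ [s _ <-]; rewrite lee_fin. Qed.

End LowSumTime.

Section MeasurableStatistics.
Context {R : realType} {K : nat} {dE dW : measure_display}.
Context {E : measurableType dE} {W : measurableType dW}.
Variables (f g : E -> R) (x : W -> obs_path K E).
Hypothesis mllr : measurable_fun [set: E] (llr f g).
Implicit Types (A : {set 'I_K}) (L n t : nat) (h : R).

Let measurable_obs k n : Prop := forall t, (0 < t <= n)%N ->
  measurable_fun [set: W] (fun w => x w t k).

Lemma measurable_cusum n k : measurable_obs k n ->
  measurable_fun [set: W] (fun w => cusum f g (x w) n k).
Proof.
elim: n => [_|n IH mx] /=; first exact: measurable_cst.
apply: measurable_maxe; last exact: measurable_cst.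
apply: emeasurable_funD.
  by apply: IH => t /andP[t0 tn]; apply: mx; rewrite t0 ltnW.
by apply: (measurableT_comp mllr); apply: mx; rewrite leqnn.
Qed.

Lemma measurable_walk a m k :
  (forall t, (a < t <= a + m)%N -> measurable_fun [set: W] (fun w => x w t k)) ->
  measurable_fun [set: W] (fun w => walk f g (x w) a m k).
Proof.
move=> mx; apply: emeasurable_sum => i.
apply: (measurableT_comp mllr); apply: mx.
by rewrite ltnS leq_addr/= -addnS leq_add2l.
Qed.

Lemma measurable_low_sum_ge A L h t : (L <= #|A|)%N ->
  (forall k, k \in A -> measurable_obs k t) ->
  measurable [set w | h%:E <= low_sum A L (cusum f g (x w) t)].
Proof.
move=> LA mx.
rewrite (_ : mkset _ = \bigcap_(J in [set J : {set 'I_K} | J \subset A /\ #|J| = L])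
    [set w | h%:E <= \sum_(k in J) cusum f g (x w) t k]); last first.
  apply/seteqP; split => w /=.
    by move=> /(low_sum_geP _ _ LA) H J [JA cJ]; exact: H.
  by move=> H; apply/(low_sum_geP _ _ LA) => J JA cJ; exact: H.
apply: fin_bigcap_measurable; first exact: finite_finset.
move=> J [JA cJ].
rewrite -[X in measurable X]setTI; apply: emeasurable_fun_c_infty => //.
under eq_fun do rewrite big_mkcond.
apply: emeasurable_sum => k; case: (boolP (k \in J)) => kJ; last exact: measurable_cst.
by apply: measurable_cusum; apply: mx; exact: (fintype.subsetP JA).
Qed.

Lemma measurable_alarm A L h t : (L <= #|A|)%N ->
  (forall k, k \in A -> measurable_obs k t) ->
  measurable [set w | low_sum_time f g A L h (x w) <= t%:R%:E].
Proof.
move=> LA mx.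
rewrite (_ : mkset _ = \bigcup_(s in [set s | (0 < s <= t)%N])
    [set w | h%:E <= low_sum A L (cusum f g (x w) s)]); last first.
  apply/seteqP; split => w /=.
    by move=> /low_sum_time_leP[s st hs]; exists s.
  by move=> [s st hs]; apply/low_sum_time_leP; exists s.
apply: bigcup_measurable => s /andP[s0 st].
apply: measurable_low_sum_ge => // k kA u /andP[u0 us]; apply: mx => //.
by rewrite u0 (leq_trans us).
Qed.

Lemma measurable_low_sum_time A L h : (L <= #|A|)%N ->
  (forall k n, k \in A -> measurable_obs k n) ->
  measurable_fun [set: W] (fun w => low_sum_time f g A L h (x w)).
Proof.
move=> LA mx; apply: (measurability _ (ErealGenInftyO.measurableE R)).
move=> _ [_ [r ->] <-]; rewrite setTI.
rewrite (_ : _ @^-1` _ = \bigcup_(n in [set n : nat | (n%:R < r)%R])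
   [set w | low_sum_time f g A L h (x w) <= n%:R%:E]).
  by apply: bigcup_measurable => n _; apply: measurable_alarm => // k kA; exact: mx.
apply/seteqP; split => w /=; rewrite in_itv/=.
  have [->//|[n Tn]] := low_sum_time_natP f g A L h (x w).
  by rewrite Tn lte_fin => nr; exists n => //=; rewrite Tn.
by move=> [n /= nr Tn]; rewrite (le_lt_trans Tn)// lte_fin.
Qed.

End MeasurableStatistics.

(** * Observations under attack *)

Section PathSpace.
Context {R : realType} {K : nat} {dE : measure_display} {E : measurableType dE}.
Variables (f g : E -> R).
Hypothesis mllr : measurable_fun [set: E] (llr f g).

(** The path space with the sigma-algebra of the history is itself a measurable
    space, to which [measurable_alarm] applies with the identity. *)
Lemma low_sum_time_stopping L h : (L <= K)%N ->
  stopping_time (low_sum_time f g [set: 'I_K]%SET L h : obs_path K E -> \bar R).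
Proof.
move=> LK; split=> [x|t]; first exact: low_sum_time_natP.
pose G := [set C | exists s j (D : set E),
        [/\ (1 <= s <= t)%N, j \in [set: 'I_K]%SET, measurable D &
            C = [set x : nat -> 'I_K -> E | D (x s j)]]].
apply: (@measurable_alarm R K dE _ E (g_sigma_algebraType G) f g
  (fun x => x) mllr).
  by rewrite cardsT card_ord.
move=> k _ s st _ D mD; rewrite setTI; apply: sub_sigma_algebra.
by exists s, k, D.
Qed.

End PathSpace.

Section Attack.
Context {R : realType} {K : nat} {d dE : measure_display}.
Context {Omega : measurableType d} {E : measurableType dE}.
Variables (N : {set 'I_K}) (X : Omega -> obs_path K E).
Implicit Types (t : nat) (pi : nat -> obs_path K E -> 'I_K -> E).

Definition honest_obs (i : nat * 'I_K) (w : Omega) : E := X w i.1 i.2.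

Definition times_in a b : set (nat * 'I_K) :=
  [set i | (a < i.1 <= b)%N /\ i.2 \in N].

(** Preimages commute with the operations of a sigma-algebra, so it suffices to
    look at single coordinates. *)
Lemma preimage_history (A : {set 'I_K}) t J (Z : Omega -> obs_path K E) :
  (forall s k, (0 < s <= t)%N -> k \in A ->
    coord_measurable honest_obs J (fun w => Z w s k)) ->
  forall C : set (obs_path K E), history A t C -> <<s coord_events honest_obs J >> (Z @^-1` C).
Proof.
move=> mZ C; apply: (@smallest_sub _ (sigma_algebra setT) _
  [set C | <<s coord_events honest_obs J >> (Z @^-1` C)]).
  split=> /=.
  - by rewrite preimage_set0; exact: sigma_algebra0.
  - by move=> B sB; rewrite setTD -preimage_setC -setTD; exact: sigma_algebraCD.
  - by move=> F sF; rewrite preimage_bigcup; exact: sigma_algebra_bigcup.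
by move=> _ [s [k [D [st kA mD ->]]]]; exact: (mZ s k st kA D mD).
Qed.

Lemma attacked_coord_measurable pi s t k : strategy N pi -> (0 < s <= t)%N ->
  coord_measurable honest_obs (times_in 0 t) (fun w => attacked N pi (X w) s k).
Proof.
move=> spi /andP[s0 st] D mD; rewrite /attacked.
have [kN|kN] := boolP (k \in N).
  by apply: sub_sigma_algebra; exists (s, k), D; rewrite /times_in/= s0 st.
have [_ /(_ D mD)] := spi s k s0 kN.
apply: preimage_history => u j /andP[u0 us] jN B mB.
apply: sub_sigma_algebra; exists (u, j), B; split=> //=.
by rewrite /times_in/= u0 (leq_trans us).
Qed.

(** What all sensors reveal is a function of the honest observations, since the
    corrupt ones are. *)
Lemma observed_history_coord pi t : strategy N pi ->
  observed_history N X pi t `<=` <<s coord_events honest_obs (times_in 0 t) >>.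
Proof.
move=> spi _ [C hC <-]; rewrite setTI; apply: preimage_history hC => s k st _.
exact: attacked_coord_measurable.
Qed.

(** Minimizing over more sensors can only lower the sum. *)
Lemma attacked_low_sum_time_ge (f g : E -> R) L h pi (w : Omega) : (L <= #|N|)%N ->
  low_sum_time f g N L h (X w) <=
  low_sum_time f g [set: 'I_K]%SET L h (attacked N pi (X w)).
Proof.
move=> LN; apply: le_ereal_inf => _ [t [t0 ht] <-]; exists t => //; split=> //.
apply: le_trans ht _; apply: le_trans (low_sumS _ (finset.subsetT N) LN) _.
rewrite /low_sum /order_stat.
have -> // : [seq cusum f g (X w) t k | k <- enum N] =
    [seq cusum f g (attacked N pi (X w)) t k | k <- enum N].
apply/eq_in_map => k; rewrite mem_enum => kN; apply: eq_cusum => s _.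
by rewrite /attacked kN.
Qed.

End Attack.

(** * One honest sensor *)

Section OneSensor.
Context {R : realType} {K : nat} {d dE : measure_display}.
Context {Omega : measurableType d} {E : measurableType dE}.
Variables (lambda : {measure set E -> \bar R}) (f g : E -> R).
Hypotheses (densf : prob_density lambda f) (densg : prob_density lambda g).
Variables (N : {set 'I_K}) (X : Omega -> obs_path K E).
Hypothesis mX : forall t k, (1 <= t)%N -> k \in N ->
  measurable_fun [set: Omega] (fun w => X w t k).
Variable P : probability Omega R.

Definition honest_index : set (nat * 'I_K) :=
  [set i : nat * 'I_K | (1 <= i.1)%N /\ i.2 \in N].

Hypothesis indX : mutually_independent P honest_index (honest_obs X).

Definition has_density (p : E -> R) t k : Prop := forall D : set E,
  measurable D -> P [set w | D (X w t k)] = \int[lambda]_(e in D) (p e)%:E.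

Definition sensor_block a b k : set (nat * 'I_K) :=
  [set i | (a < i.1 <= b)%N /\ i.2 = k].

Let mllr : measurable_fun [set: E] (llr f g).
Proof. exact: measurable_llr densf densg. Qed.

Let mobs i : honest_index i -> measurable_fun [set: Omega] (honest_obs X i).
Proof. by case: i => t k [/= t1 kN]; exact: mX. Qed.

Lemma sensor_block_honest a b k : k \in N -> sensor_block a b k `<=` honest_index.
Proof. by move=> kN [t j] /= [/andP[/= ta _] ->]; split=> //=; exact: leq_trans ta. Qed.

Lemma integral_obs (p : E -> R) t k (phi : E -> \bar R) :
  measurable_fun [set: E] p -> (forall e, (0 <= p e)%R) ->
  (1 <= t)%N -> k \in N -> has_density p t k ->
  measurable_fun [set: E] phi -> (forall e, 0 <= phi e) ->
  \int[P]_w phi (X w t k) = \int[lambda]_e (phi e * (p e)%:E).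
Proof.
move=> mp p0 t1 kN law mphi phi0.
have mXt := mX t1 kN.
rewrite -(ge0_integral_density (nu := pushforward P (fun w => X w t k)) mp p0)//.
by rewrite ge0_integral_pushforward.
Qed.

Lemma walk_coord_measurable a m k :
  coord_measurable (honest_obs X) (sensor_block a (a + m) k)
    (fun w => walk f g (X w) a m k).
Proof.
apply/coord_measurableP; apply: measurable_walk => // t tm.
by apply: (@measurable_fun_coord _ _ _ _ _ (honest_obs X) _ (t, k)).
Qed.

Lemma measurable_sensor_walk a m k : k \in N ->
  measurable_fun [set: Omega] (fun w => walk f g (X w) a m k).
Proof.
move=> kN; apply: measurable_walk => // t /andP[ta _]; apply: mX => //.
exact: leq_trans ta.
Qed.

Lemma llr_coord_measurable t k (phi : \bar R -> \bar R) :
  measurable_fun setT phi -> (1 <= t)%N ->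
  coord_measurable (honest_obs X) (sensor_block t.-1 t k)
    (fun w => phi (llr f g (X w t k))).
Proof.
move=> mphi t1; apply/coord_measurableP.
apply: (measurableT_comp mphi); apply: (measurableT_comp mllr).
apply: (@measurable_fun_coord _ _ _ _ _ (honest_obs X) _ (t, k)).
by rewrite /sensor_block/= prednK// leqnn.
Qed.

(** By submultiplicativity and the independence of the increments, the bounds for
    single observations multiply. *)
Lemma integral_exp_neg_walk s (C : R) a m k : (0 < s)%R -> k \in N ->
  (forall t, (a < t <= a + m)%N -> has_density g t k) ->
  \int[lambda]_e (exp_neg s (llr f g e) * (g e)%:E) <= C%:E ->
  \int[P]_w exp_neg s (walk f g (X w) a m k) <= (C ^+ m)%:E.
Proof.
move=> s0 kN law IC.
have mq := @measurable_exp_neg R s.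
have C0 : (0 <= C)%R.
  rewrite -lee_fin (le_trans _ IC)// integral_ge0// => e _.
  by rewrite mule_ge0 ?exp_neg_ge0 ?lee_fin//; case: densg.
elim: m => [|m IH] in law *.
  under eq_integral do rewrite walk0 /exp_neg/= mulr0 expR0.
  by rewrite integral_cst// mul1e expr0 probability_le1.
have -> : (C ^+ m.+1)%:E = (C ^+ m)%:E * C%:E by rewrite exprSr EFinM.
apply: (@le_trans _ _ (\int[P]_w (exp_neg s (walk f g (X w) a m k) *
    exp_neg s (llr f g (X w (a + m).+1 k))))).
  apply: ge0_le_integral => //.
  - by move=> w _; exact: exp_neg_ge0.
  - exact: measurableT_comp mq (measurable_sensor_walk _ _ kN).
  - apply: emeasurable_funM; first exact: measurableT_comp mq (measurable_sensor_walk _ _ kN).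
    by apply: (measurableT_comp mq); apply: (measurableT_comp mllr); exact: mX.
  - by move=> w _; rewrite walkS exp_negD.
have mqc : coord_measurable (honest_obs X) (sensor_block a (a + m) k)
    (fun w => exp_neg s (walk f g (X w) a m k)).
  by apply: (coord_measurable_comp mq); exact: walk_coord_measurable.
have disj : sensor_block a (a + m) k `&`
    sensor_block (a + m).+1.-1 (a + m).+1 k = set0.
  apply/seteqP; split=> -[t j]//= [[/andP[_ t1] _] [/andP[t2 _] _]].
  by move: t1 t2 => /= t1 t2; lia.
have q0 x := @exp_neg_ge0 R s x.
rewrite (coord_indep_integralM mobs indX (sensor_block_honest kN)
  (sensor_block_honest kN) disj mqc
  (@llr_coord_measurable (a + m).+1 k _ mq isT))//.
apply: lee_pmul.
- by apply: integral_ge0 => w _; exact: exp_neg_ge0.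
- by apply: integral_ge0 => w _; exact: exp_neg_ge0.
- by apply: IH => t /andP[ta tm]; apply: law; rewrite ta addnS ltnW.
rewrite (integral_obs (p := g) (phi := fun e => exp_neg s (llr f g e)))//.
- by case: densg.
- by case: densg.
- by apply: law; rewrite addnS ltnS leq_addr leqnn.
- exact: measurableT_comp mq mllr.
Qed.

Variable Ir : R.
Hypothesis defI : Ir%:E = \int[lambda]_e (llr f g e * (g e)%:E).

(** Markov's inequality for [exp_neg s] of the walk; the bound decays
    exponentially in [m] when [c] is below [m * (Ir - eps)]. *)
Lemma walk_lower_tail s eps (c : R) a m k : (0 < s)%R -> k \in N ->
  (forall t, (a < t <= a + m)%N -> has_density g t k) ->
  \int[lambda]_e (exp_neg s (llr f g e) * (g e)%:E) <=
    (expR (- (s * (Ir - eps))))%:E ->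
  P [set w | walk f g (X w) a m k <= c%:E] <=
    (expR (s * (c - m%:R * (Ir - eps))))%:E.
Proof.
move=> s0 kN law IC; have EC := integral_exp_neg_walk s0 kN law IC.
set A := [set w | _].
have mA : measurable A.
  rewrite -[A]setTI; apply: emeasurable_fun_infty_c => //.
  exact: measurable_sensor_walk.
have mq := @measurable_exp_neg R s.
have : (expR (- (s * c)))%:E * P A <= (expR (- (s * (Ir - eps))) ^+ m)%:E.
  apply: le_trans EC.
  apply: measure_le_integral => //.
  - exact: measurableT_comp mq (measurable_sensor_walk _ _ kN).
  - by move=> w; exact: exp_neg_ge0.
  - by move=> w; exact: exp_neg_markov.
rewrite -expRM_natl -(fineK (fin_num_measure P _ mA)) -EFinM !lee_fin => H.
have e1 : (expR (s * c) * expR (- (s * c)) = 1)%R by rewrite expRxMexpNx_1.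
have := ler_wpM2l (expR_ge0 (s * c)) H; rewrite mulrA e1 mul1r => /le_trans; apply.
by rewrite -expRD ler_expR le_eqVlt; apply/orP; left; apply/eqP; ring.
Qed.

End OneSensor.

Section OneSensorAfterChange.
Context {R : realType} {K : nat} {d dE : measure_display}.
Context {Omega : measurableType d} {E : measurableType dE}.
Variables (lambda : {measure set E -> \bar R}) (f g : E -> R).
Hypotheses (densf : prob_density lambda f) (densg : prob_density lambda g).
Variables (N : {set 'I_K}) (X : Omega -> obs_path K E).
Hypothesis mX : forall t k, (1 <= t)%N -> k \in N ->
  measurable_fun [set: Omega] (fun w => X w t k).
Variable P : probability Omega R.
Hypothesis indX : mutually_independent P (honest_index N) (honest_obs X).
Variable Ir : R.
Hypothesis defI : Ir%:E = \int[lambda]_e (llr f g e * (g e)%:E).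
Hypothesis Ir0 : (0 < Ir)%R.

Let mllr : measurable_fun [set: E] (llr f g).
Proof. exact: measurable_llr densf densg. Qed.
Let mg : measurable_fun [set: E] g. Proof. by case: densg. Qed.
Let g0 e : (0 <= g e)%R. Proof. by case: densg. Qed.

Local Notation walk x a m k := (walk f g x a m k).
Local Notation cusum x t k := (cusum f g x t k).

Lemma integrable_obs_llr t k : (1 <= t)%N -> k \in N ->
  has_density lambda X P g t k ->
  P.-integrable [set: Omega] (fun w => llr f g (X w t k)) /\
  \int[P]_w llr f g (X w t k) = Ir%:E.
Proof.
move=> t1 kN law; have mXt := mX t1 kN.
have IX (phi : E -> \bar R) : measurable_fun setT phi -> (forall e, 0 <= phi e) ->
    \int[P]_w phi (X w t k) = \int[lambda]_e (phi e * (g e)%:E).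
  exact: (integral_obs mX mg g0 t1 kN law).
split.
  apply/integrableP; split; first exact: measurableT_comp.
  rewrite (IX (fun e => `|llr f g e|)) //; last exact: measurableT_comp.
  have /integrableP[_] := integrable_llr densf densg defI.
  under eq_integral => e _ do rewrite abseM (@gee0_abs _ (g e)%:E) ?lee_fin//.
  by [].
rewrite defI [LHS]integralE [RHS]integralE; congr (_ - _).
  transitivity (\int[P]_w (llr f g)^\+ (X w t k)).
    by apply: eq_integral => w _; rewrite !funeposE.
  rewrite (IX (llr f g)^\+)//.
    apply: eq_integral => e _; rewrite !funeposE.
    by rewrite maxe_pMl ?lee_fin ?mul0e.
  exact: measurable_funepos.
transitivity (\int[P]_w (llr f g)^\- (X w t k)).
  by apply: eq_integral => w _; rewrite !funenegE.
  rewrite (IX (llr f g)^\-)//.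
  apply: eq_integral => e _; rewrite !funenegE.
  by rewrite maxe_pMl ?lee_fin ?mul0e// mulNe.
exact: measurable_funeneg.
Qed.

Lemma integral_walk a m k : k \in N ->
  (forall t, (a < t <= a + m)%N -> has_density lambda X P g t k) ->
  P.-integrable [set: Omega] (fun w => walk (X w) a m k) /\
  \int[P]_w walk (X w) a m k = (m%:R * Ir)%:E.
Proof.
move=> kN; elim: m => [|m IH] law.
  rewrite (_ : (fun w => walk (X w) a 0 k) = cst 0); last first.
    by apply/funext => w; rewrite walk0.
  split; first exact: integrable0.
  by rewrite integral0 mul0r.
have [im Im] := IH (fun t tm => law t ltac:(move: tm; clear; lia)).
have [i1 I1] := integrable_obs_llr (ltn0Sn (a + m)) kN (law (a + m).+1 ltac:(clear; lia)).
rewrite (_ : (fun w => walk (X w) a m.+1 k) =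
    (fun w => walk (X w) a m k) \+ (fun w => llr f g (X w (a + m).+1 k))); last first.
  by apply/funext => w; rewrite walkS.
split; first exact: integrableD.
by rewrite integralD// Im I1 -EFinD -natr1 mulrDl mul1r.
Qed.

(** For finite [S] the negative part can be moved to the right, and the claim is
    [c2 <= S] in the first case and [u <= expR (s * u) / s] with [u = c1 - S] in
    the second. Keeping the parts separate makes all terms nonnegative. *)
Let upper_tail_pointwise (s c1 c2 : R) (S : \bar R) :
  (0 < s)%R -> (0 <= c1)%R -> (c1 <= c2)%R ->
  (if c2%:E <= S then (c2 - c1)%:E else 0) + c1%:E + maxe (- S) 0 <=
  maxe S 0 + exp_neg s S * (expR (s * c1) / s)%:E.
Proof.
move=> s0 c10 c12.
have es0 : (0 < expR (s * c1) / s)%R by rewrite divr_gt0 ?expR_gt0.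
case: S => [x| |]; last 2 first.
- have -> : exp_neg s +oo = +oo by [].
  by rewrite gt0_mulye ?lte_fin// addey ?leey// max_l ?leey.
- rewrite exp_negN// gt0_mulye ?lte_fin//.
  by rewrite addey ?leey// max_r ?leNye.
rewrite exp_negE lee_fin -EFinN -!EFin_max -EFinM -EFinD.
have h : (expR (- (s * x)) * (expR (s * c1) / s) >= c1 - x)%R.
  rewrite mulrA -expRD ler_pdivlMr//.
  have := expR_ge1Dx (- (s * x) + s * c1); nra.
have hq : (0 <= expR (- (s * x)) * (expR (s * c1) / s))%R.
  by rewrite mulr_ge0 ?expR_ge0// ltW.
have hm : (Num.max x 0 - Num.max (- x) 0 = x)%R.
  have [x0|x0] := leP 0%R x.
    have nx : (- x <= 0)%R by rewrite oppr_le0.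
    by rewrite (max_r nx) subr0.
  have nx : (0 <= - x)%R by rewrite oppr_ge0 ltW.
  by rewrite (max_l nx) sub0r opprK.
case: (leP c2 x) => xc; rewrite ?add0e -!EFinD lee_fin; lra.
Qed.

(** Weak law of large numbers for the upper tail under a first moment only: the
    lower tail is exponentially small, so the mean leaves no room for an
    excess. *)
Lemma walk_upper_tail (e delta : R) : (0 < e)%R -> (0 < delta)%R ->
  exists m0, forall a m, (m0 <= m)%N -> forall k, k \in N ->
    (forall t, (a < t <= a + m)%N -> has_density lambda X P g t k) ->
    P [set w | (m%:R * (Ir + e))%:E <= walk (X w) a m k] <= delta%:E.
Proof.
move=> e0 delta0.
(* After division by [m * e] the errors of the bound are [eps / e] and
   [1 / (s * m * e)]; each is made at most [delta / 2]. *)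
pose eps := Num.min Ir (e * delta / 2)%R.
have eps0 : (0 < eps)%R by rewrite lt_min Ir0/=; nra.
have epsI : (eps <= Ir)%R by rewrite ge_min lexx.
have epsd : (eps <= e * delta / 2)%R by rewrite ge_min lexx orbT.
have [s [s0 _ Is]] := exp_neg_llr_small densf densg defI eps0 ltr01.
exists (Num.bound (2 / (s * e * delta))%R).+1 => a m m0m k kN law.
have m0 : (0 < m%:R :> R)%R by rewrite ltr0n (leq_trans _ m0m).
have sm : (2 <= m%:R * (s * e * delta))%R.
  rewrite -ler_pdivrMr ?mulr_gt0// ltW//.
  apply: (lt_le_trans (archi_boundP _)); first by rewrite divr_ge0// ltW// !mulr_gt0.
  by rewrite ler_nat ltnW.
have [iW IW] := integral_walk kN law.
have mW := measurable_sensor_walk densf densg mX a m kN.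
set c1 := (m%:R * (Ir - eps))%R; set c2 := (m%:R * (Ir + e))%R.
set A := [set w | _].
have mA : measurable A.
  by rewrite -[A]setTI; apply: emeasurable_fun_c_infty.
have c10 : (0 <= c1)%R by rewrite mulr_ge0 ?subr_ge0// ltW.
have c12 : (c1 <= c2)%R by rewrite ler_wpM2l ?(ltW m0)//; lra.
pose W w := walk (X w) a m k.
pose cc := (expR (s * c1) / s)%R.
have cc0 : (0 <= cc)%R by rewrite divr_ge0 ?expR_ge0// ltW.
have mq : measurable_fun setT (fun w => exp_neg s (W w)).
  exact: measurableT_comp (@measurable_exp_neg R s) mW.
have mind : measurable_fun setT (fun w => (c2 - c1)%:E * (\1_A w : R)%:E).
  by apply: measurable_funeM; exact/measurable_EFinP.
have mWp := measurable_funepos mW; have mWn := measurable_funeneg mW.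
have ind0 w : 0 <= (c2 - c1)%:E * (\1_A w : R)%:E.
  by rewrite -EFinM lee_fin mulr_ge0// subr_ge0.
have c1E0 : 0 <= c1%:E by rewrite lee_fin.
have mqc : measurable_fun setT (fun w => exp_neg s (W w) * cc%:E).
  by apply: emeasurable_funM => //; exact: measurable_cst.
have q0 w : 0 <= exp_neg s (W w) by exact: exp_neg_ge0.
have qc0 w : 0 <= exp_neg s (W w) * cc%:E by rewrite mule_ge0.
have c1E0' w : 0 <= (c2 - c1)%:E * (\1_A w)%:E + c1%:E by exact: adde_ge0.
have mindc : measurable_fun setT (fun w => (c2 - c1)%:E * (\1_A w : R)%:E + c1%:E).
  by apply: emeasurable_funD => //; exact: measurable_cst.
have : \int[P]_w ((c2 - c1)%:E * (\1_A w)%:E + c1%:E + W^\- w) <=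
       \int[P]_w (W^\+ w + exp_neg s (W w) * cc%:E).
  apply: ge0_le_integral => //.
  - by move=> w _; exact: adde_ge0.
  - exact: emeasurable_funD.
  - exact: emeasurable_funD.
  - move=> w _; have := upper_tail_pointwise (W w) s0 c10 c12.
    rewrite funeposE funenegE indicE.
    case: (boolP (c2%:E <= W w)) => cW.
      by rewrite mem_set// mule1.
    by rewrite memNset ?mule0//; exact/negP.
rewrite ge0_integralD// ge0_integralD// ge0_integralZl//; last 2 first.
- exact/measurable_EFinP.
- by rewrite lee_fin subr_ge0.
rewrite integral_indic// setIT integral_cst_probability.
rewrite ge0_integralD// ge0_integralZr//.
have Iq : \int[P]_w exp_neg s (W w) <= (expR (- (s * (Ir - eps))) ^+ m)%:E.
  exact: (integral_exp_neg_walk densf densg mX indX s0 kN law Is).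
have fp := integrable_pos_fin_num measurableT iW.
have fn := integrable_neg_fin_num measurableT iW.
have : \int[P]_w W^\+ w - \int[P]_w W^\- w = (m%:R * Ir)%:E.
  by rewrite -IW [RHS]integralE.
rewrite -[\int[P]_w W^\+ w]fineK// -[\int[P]_w W^\- w]fineK//.
rewrite -[P A]fineK ?fin_num_measure//.
set ip := fine _; set iq := fine _; set p := fine _.
rewrite -EFinB => -[ipq] H.
have : (((c2 - c1) * p + c1 + iq)%:E <= (ip + 1 / s)%:E).
  rewrite 2!EFinD EFinM {1}/p fineK ?fin_num_measure// [leRHS]EFinD.
  apply: le_trans H _; rewrite leeD2l//.
  apply: le_trans (lee_wpmul2r _ Iq) _; first by rewrite lee_fin.
  rewrite -EFinM lee_fin /cc mulrA ler_pM2r ?invr_gt0//.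
  rewrite -expRM_natl -expRD (_ : (_ + _ = 0)%R) ?expR0// /c1; ring.
rewrite !lee_fin /c1 /c2 => H2.
have p0 : (0 <= p)%R by rewrite fine_ge0.
have {}H2 : (m%:R * e * p <= m%:R * eps + s^-1)%R.
  have : (0 <= m%:R * eps * p)%R by rewrite !mulr_ge0// ltW.
  move: H2 ipq; rewrite div1r; nra.
have sV : (s^-1 <= m%:R * e * delta / 2)%R.
  rewrite ler_pdivlMr// -(ler_pM2l s0) mulrA divff ?mul1r ?gt_eqF//.
  by apply: le_trans sm _; rewrite le_eqVlt; apply/orP; left; apply/eqP; ring.
have me : (m%:R * eps <= m%:R * e * delta / 2)%R.
  by rewrite -!mulrA ler_pM2l// mulrA.
rewrite -(@ler_pM2l _ (m%:R * e))%R; last by rewrite mulr_gt0.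
lra.
Qed.

End OneSensorAfterChange.

Section LinearTimesExp.
Context {R : realType}.
Local Open Scope ring_scope.

Lemma linear_expN_small (c delta : R) : 0 < c -> 0 < delta ->
  exists n0, forall n, (n0 <= n)%N -> n.+1%:R * expR (- (c * n%:R)) <= delta.
Proof.
move=> c0 d0.
(* Compare [n.+1 <= 2 * n] with [expR y >= y ^+ 2 / 2] at [y = c * n]. *)
exists (Num.bound (4 / (c ^+ 2 * delta))).+1 => n n0n.
have n0 : 1 <= n%:R :> R by rewrite ler1n (leq_trans _ n0n).
have cd0 : 0 < c ^+ 2 * delta by rewrite mulr_gt0// exprn_gt0.
have cn : 4 <= n%:R * (c ^+ 2 * delta).
  rewrite -ler_pdivrMr// ltW//.
  apply: (lt_le_trans (archi_boundP _)); first by rewrite divr_ge0// ltW.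
  by rewrite ler_nat ltnW.
have x0 : 0 <= c * n%:R by rewrite mulr_ge0 ?(ltW c0).
have : 1 + (c * n%:R) ^+ 2 / 2 <= expR (c * n%:R) := expR_ge1Dxn 1 x0.
move=> ex.
rewrite expRN ler_pdivrMr ?expR_gt0// -natr1.
apply: (@le_trans _ _ (delta * ((c * n%:R) ^+ 2 / 2))); last first.
  by rewrite ler_pM2l//; lra.
have -> : delta * ((c * n%:R) ^+ 2 / 2) = n%:R * (n%:R * (c ^+ 2 * delta)) / 2.
  by ring.
nra.
Qed.

End LinearTimesExp.

Lemma probability_bigsetU_le {R : realType} {d} {Omega : measurableType d}
    (P : probability Omega R) n (A : nat -> set Omega) (b : R) :
  (forall i, (i < n)%N -> measurable (A i)) ->
  (forall i, (i < n)%N -> P (A i) <= b%:E) ->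
  P (\big[setU/set0]_(i < n) A i) <= (n%:R * b)%:E.
Proof.
elim: n => [|n IH] mA bA; first by rewrite big_ord0 measure0 mul0r.
rewrite big_ord_recr /= (le_trans (measureU2 _ _ _))//.
- by apply: bigsetU_measurable => i _; apply: mA; exact: leqW (ltn_ord i).
- exact: mA.
rewrite -natr1 mulrDl mul1r EFinD leeD ?bA// IH// => i ni.
  by apply: mA; exact: leqW.
by apply: bA; exact: leqW.
Qed.

Section CusumBounds.
Context {R : realType} {K : nat} {d dE : measure_display}.
Context {Omega : measurableType d} {E : measurableType dE}.
Variables (lambda : {measure set E -> \bar R}) (f g : E -> R).
Hypotheses (densf : prob_density lambda f) (densg : prob_density lambda g).
Variables (N : {set 'I_K}) (X : Omega -> obs_path K E).
Hypothesis mX : forall t k, (1 <= t)%N -> k \in N ->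
  measurable_fun [set: Omega] (fun w => X w t k).
Variable P : probability Omega R.
Hypothesis indX : mutually_independent P (honest_index N) (honest_obs X).

Let mllr : measurable_fun [set: E] (llr f g).
Proof. exact: measurable_llr densf densg. Qed.

Local Notation walk x a m k := (walk f g x a m k).
Local Notation cusum x t k := (cusum f g x t k).

Let mobs i : honest_index N i -> measurable_fun [set: Omega] (honest_obs X i).
Proof. by case: i => t k [/= t1 kN]; exact: mX. Qed.

Let measurable_walk_le a m k (c : R) : k \in N ->
  measurable [set w | walk (X w) a m k <= c%:E].
Proof.
move=> kN; rewrite -[S in measurable S]setTI; apply: emeasurable_fun_infty_c => //.
exact: (measurable_sensor_walk densf densg mX a m kN).
Qed.

Lemma expeRMD (theta : R) (x y : \bar R) : (0 < theta)%R ->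
  expeR (theta%:E * (x + y)) = expeR (theta%:E * x) * expeR (theta%:E * y).
Proof.
move=> t0; rewrite -expeRD; congr expeR.
by case: x => [x| |]; case: y => [y| |];
  rewrite ?gt0_muley ?gt0_muleNy ?lte_fin//= -?EFinD -?EFinM ?mulrDr//.
Qed.

Section BeforeChange.
Variables (theta rho : R).
Hypotheses (theta0 : (0 < theta)%R) (rho1 : (rho < 1)%R).
Hypothesis Irho :
  \int[lambda]_e (expeR (theta%:E * llr f g e) * (f e)%:E) <= rho%:E.

Let mexp : measurable_fun [set: \bar R] (fun y => expeR (theta%:E * y)).
Proof.
apply: (measurableT_comp (@measurable_expeR R)).
exact: measurable_funeM.
Qed.

Lemma cusum_coord_measurable t k :
  coord_measurable (honest_obs X) (sensor_block 0 t k)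
    (fun w => cusum (X w) t k).
Proof.
apply/coord_measurableP; apply: measurable_cusum => // u ut.
by apply: (@measurable_fun_coord _ _ _ _ _ (honest_obs X) _ (u, k)).
Qed.

Lemma measurable_sensor_cusum t k : k \in N ->
  measurable_fun [set: Omega] (fun w => cusum (X w) t k).
Proof.
by move=> kN; apply: measurable_cusum => // u /andP[u0 _]; exact: mX.
Qed.

(** One step maps the moment [z] to at most [1 + rho * z], as
    [expR (maxr x 0) <= 1 + expR x]; the bound is the fixed point. *)
Lemma integral_exp_cusum_le t k : k \in N ->
  (forall u, (0 < u)%N -> has_density lambda X P f u k) ->
  \int[P]_w expeR (theta%:E * cusum (X w) t k) <= ((1 - rho)^-1)%:E.
Proof.
move=> kN law.
have rho0 : (0 <= rho)%R.
  rewrite -lee_fin (le_trans _ Irho)// integral_ge0// => e _.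
  by rewrite mule_ge0 ?expeR_ge0 ?lee_fin//; case: densf.
have r1 : (0 < 1 - rho)%R by rewrite subr_gt0.
have V1 : (1 <= (1 - rho)^-1)%R by rewrite invf_ge1//; lra.
elim: t => [|t IH].
  under eq_integral do rewrite [cusum _ _ _]/= mule0 expeR0.
  by rewrite (integral_cst_probability P 1) lee_fin.
have mY := measurableT_comp mexp (measurable_sensor_cusum t kN).
have ml : measurable_fun setT (fun w => llr f g (X w t.+1 k)).
  by apply: (measurableT_comp mllr); exact: mX.
have mel := measurableT_comp mexp ml.
have e0 (y : \bar R) : 0 <= expeR y := expeR_ge0 y.
have disj : sensor_block 0 t k `&` sensor_block t.+1.-1 t.+1 k = set0.
  apply/seteqP; split=> -[u j]//= [[/andP[_ t1] _] [/andP[t2 _] _]].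
  by move: t1 t2 => /= t1 t2; lia.
apply: (@le_trans _ _ (\int[P]_w (1%:E + expeR (theta%:E * cusum (X w) t k) *
    expeR (theta%:E * llr f g (X w t.+1 k))))).
  apply: ge0_le_integral => //.
  - exact: measurableT_comp mexp (measurable_sensor_cusum t.+1 kN).
  - by apply: emeasurable_funD => //; exact: emeasurable_funM.
  - move=> w _; rewrite -expeRMD// [cusum _ t.+1 _]/=.
    have [_|_] := leP (cusum (X w) t k + llr f g (X w t.+1 k)) 0.
      by rewrite mule0 expeR0 leeDl.
    by rewrite leeDr.
rewrite ge0_integralD//; last 2 first.
- by move=> w _; exact: mule_ge0.
- exact: emeasurable_funM.
rewrite integral_cst_probability.
rewrite (coord_indep_integralM mobs indX (sensor_block_honest kN)
  (sensor_block_honest kN) disj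
  (coord_measurable_comp mexp (@cusum_coord_measurable t k))
  (@llr_coord_measurable _ _ _ _ _ _ _ _ _ densf densg X t.+1 k _ mexp isT))//.
have -> : ((1 - rho)^-1 = 1 + (1 - rho)^-1 * rho)%R.
  by field; rewrite gt_eqF.
rewrite EFinD leeD2l// EFinM lee_pmul ?integral_ge0//.
have mf : measurable_fun setT f by case: densf.
have f0 e : (0 <= f e)%R by case: densf.
rewrite (integral_obs mX mf f0 _ kN (law t.+1 isT) (phi := fun e => expeR (theta%:E * llr f g e)))//.
exact: measurableT_comp mexp mllr.
Qed.

Let markov_exp (Z : Omega -> \bar R) (D c : R) :
  measurable_fun [set: Omega] Z ->
  \int[P]_w expeR (theta%:E * Z w) <= D%:E ->
  P [set w | c%:E <= Z w] <= (D * expR (- (theta * c)))%:E.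
Proof.
move=> mZ ID.
set A := [set w | _].
have mA : measurable A.
  by rewrite -[A]setTI; exact: emeasurable_fun_c_infty.
have : (expR (theta * c))%:E * P A <= D%:E.
  apply: le_trans ID; apply: measure_le_integral => //.
  - exact: measurableT_comp mexp mZ.
  - by move=> w; exact: expeR_ge0.
  - move=> w /= cZ; rewrite -[(expR _)%:E]/(expeR (theta * c)%:E) lee_expeR.
    by rewrite EFinM lee_pmul2l// lte_fin.
rewrite -(fineK (fin_num_measure P _ mA)) -EFinM !lee_fin => H.
by rewrite expRN ler_pdivlMr ?expR_gt0// mulrC.
Qed.

Lemma cusum_before_change_le (e delta : R) : (0 < e)%R -> (0 < delta)%R ->
  exists n0, forall n, (n0 <= n)%N -> forall k, k \in N ->
    (forall t, (0 < t)%N -> has_density lambda X P f t k) ->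
    exists A, [/\ measurable A, P A <= delta%:E & forall w, ~ A w ->
      forall t, (t <= n)%N -> cusum (X w) t k < (n%:R * e)%:E].
Proof.
move=> e0 delta0.
have r1 : (0 < 1 - rho)%R by rewrite subr_gt0.
have te : (0 < theta * e)%R by rewrite mulr_gt0.
have dr : (0 < delta * (1 - rho))%R by rewrite mulr_gt0.
have [n0 Hn0] := linear_expN_small te dr.
exists n0 => n n0n k kN law.
pose A t := [set w | (n%:R * e)%:E <= cusum (X w) t k].
have mA t : measurable (A t).
  rewrite -[A t]setTI; apply: emeasurable_fun_c_infty => //.
  exact: measurable_sensor_cusum.
exists (\big[setU/set0]_(t < n.+1) A t); split.
- by apply: bigsetU_measurable => t _; exact: mA.
- apply: (@le_trans _ _
    (n.+1%:R * ((1 - rho)^-1 * expR (- (theta * (n%:R * e)))))%:E).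
    apply: probability_bigsetU_le => t _; first exact: mA.
    apply: markov_exp; first exact: measurable_sensor_cusum.
    exact: integral_exp_cusum_le.
  rewrite lee_fin mulrCA mulrC ler_pdivrMr//.
  by apply: le_trans (Hn0 n n0n); rewrite mulrA mulrAC.
- move=> w nA t tn; rewrite ltNge; apply/negP => hw; apply: nA.
  by rewrite -bigcup_mkord; exists t.
Qed.

(** Exponential moments of the sensors multiply, since different sensors are
    independent. *)
Let integral_prod_exp_cusum t (s : seq 'I_K) : uniq s ->
  {subset s <= N} ->
  (forall u k, k \in N -> (0 < u)%N -> has_density lambda X P f u k) ->
  \int[P]_w (\prod_(k <- s) expeR (theta%:E * cusum (X w) t k)) <=
    ((1 - rho)^-1 ^+ size s)%:E.
Proof.
move=> + + law; elim: s => [_ _|k s IH /= /andP[ks us] sN].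
  under eq_integral do rewrite big_nil.
  by rewrite (integral_cst_probability P 1) expr0.
have kN : k \in N by apply: sN; rewrite mem_head.
have {}sN : {subset s <= N} by move=> j js; apply: sN; rewrite inE js orbT.
pose Js : set (nat * 'I_K) := [set i | (0 < i.1 <= t)%N /\ i.2 \in s].
have JsH : Js `<=` honest_index N.
  by move=> [u j] [/andP[/= u0 _] /= js]; split=> //; exact: sN.
have e0 (y : \bar R) : 0 <= expeR y := expeR_ge0 y.
have p0 w (r : seq 'I_K) : 0 <= \prod_(j <- r) expeR (theta%:E * cusum (X w) t j).
  by elim/big_ind: _ => //; exact: mule_ge0.
have disj : sensor_block 0 t k `&` Js = set0.
  apply/seteqP; split=> -[u j]//= [[_ /= jk] [_ /= js]].
  by move: ks; rewrite -jk js.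
have cs : coord_measurable (honest_obs X) Js
    (fun w => \prod_(j <- s) expeR (theta%:E * cusum (X w) t j)).
  apply/coord_measurableP.
  have : {subset s <= s} by [].
  elim: {-2}s => [_|j r IHr rs].
    by under eq_fun do rewrite big_nil; exact: measurable_cst.
  under eq_fun do rewrite big_cons.
  apply: emeasurable_funM; last first.
    by apply: IHr => l lr; apply: rs; rewrite inE lr orbT.
  apply: (measurableT_comp mexp); apply: measurable_cusum => // u ut.
  apply: (@measurable_fun_coord _ _ _ _ _ (honest_obs X) _ (u, j)).
  by split=> //=; apply: rs; rewrite mem_head.
under eq_integral do rewrite big_cons.
rewrite (coord_indep_integralM mobs indX (sensor_block_honest kN) JsH disj
  (coord_measurable_comp mexp (@cusum_coord_measurable t k)) cs)//.
rewrite exprS EFinM lee_pmul ?integral_ge0//.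
  by apply: integral_exp_cusum_le => // u u0; exact: law.
exact: IH.
Qed.

Lemma sum_cusum_before_change_tail t (h : R) :
  (forall u k, k \in N -> (0 < u)%N -> has_density lambda X P f u k) ->
  P [set w | h%:E <= \sum_(k in N) cusum (X w) t k] <=
    ((1 - rho)^-1 ^+ #|N| * expR (- (theta * h)))%:E.
Proof.
move=> law; apply: markov_exp.
  under eq_fun do rewrite big_mkcond.
  apply: emeasurable_sum => k; case: (boolP (k \in N)) => kN.
    exact: measurable_sensor_cusum.
  exact: measurable_cst.
rewrite cardE; apply: le_trans (integral_prod_exp_cusum t (enum_uniq N) _ law).
  rewrite (_ : (fun w => expeR _) = fun w => \prod_(k <- enum N)
      expeR (theta%:E * cusum (X w) t k))//.
  apply/funext => w; rewrite -big_enum /=.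
  elim: (enum N) => [|k s IH]; first by rewrite !big_nil mule0 expeR0.
  by rewrite !big_cons expeRMD// IH.
by move=> k; rewrite mem_enum.
Qed.

End BeforeChange.

Variable Ir : R.
Hypothesis defI : Ir%:E = \int[lambda]_e (llr f g e * (g e)%:E).
Hypothesis Ir0 : (0 < Ir)%R.

(** Up to time [n] a CUSUM of positive drift never rises much above the mean of
    its walk at time [n]: it is its walk minus the running minimum, and the lower tail bound,
    summed over the [n.+1] times, keeps both this minimum and the increments from
    [t] to [n] above [- n * e / 3]. *)
Lemma cusum_after_change_le (e delta : R) : (0 < e)%R -> (0 < delta)%R ->
  exists n0, forall n, (n0 <= n)%N -> forall k, k \in N ->
    (forall t, (0 < t)%N -> has_density lambda X P g t k) ->
    exists A, [/\ measurable A, P A <= delta%:E & forall w, ~ A w ->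
      forall t, (t <= n)%N -> cusum (X w) t k < (n%:R * (Ir + e))%:E].
Proof.
move=> e0 delta0.
have e3 : (0 < e / 3)%R by rewrite divr_gt0.
have d2 : (0 < delta / 2)%R by rewrite divr_gt0.
have d4 : (0 < delta / 4)%R by rewrite divr_gt0.
have [n1 Hn1] := walk_upper_tail densf densg mX indX defI Ir0 e3 d2.
(* With [eps = Ir] the tail bound does not depend on the length of the walk. *)
have [s [s0 _ Is]] := exp_neg_llr_small densf densg defI Ir0 ltr01.
have se : (0 < s * (e / 3))%R by rewrite mulr_gt0.
have [n2 Hn2] := linear_expN_small se d4.
exists (maxn n1 n2) => n; rewrite geq_max => /andP[n1n n2n] k kN law.
pose c := (n%:R * (e / 3))%R.
pose A0 := [set w | (n%:R * (Ir + e / 3))%:E <= walk (X w) 0 n k].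
pose A1 t := [set w | walk (X w) 0 t k <= (- c)%:E].
pose A2 t := [set w | walk (X w) t (n - t) k <= (- c)%:E].
have mA0 : measurable A0.
  rewrite -[A0]setTI; apply: emeasurable_fun_c_infty => //.
  exact: (measurable_sensor_walk densf densg mX 0 n kN).
have tail a m : P [set w | walk (X w) a m k <= (- c)%:E] <=
    (expR (- (s * (e / 3) * n%:R)))%:E.
  have := @walk_lower_tail _ _ _ _ _ _ _ _ _ densf densg _ _ mX _ indX Ir s Ir
    (- c) a m k s0 kN (fun t tm => law t ltac:(move: tm; clear; lia)) Is.
  by rewrite subrr mulr0 subr0 /c (_ : (s * - _ = - (s * (e / 3) * n%:R))%R); last by ring.
pose U1 := \big[setU/set0]_(t < n.+1) A1 t.
pose U2 := \big[setU/set0]_(t < n.+1) A2 t.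
have mU1 : measurable U1.
  by apply: bigsetU_measurable => t _; exact: measurable_walk_le.
have mU2 : measurable U2.
  by apply: bigsetU_measurable => t _; exact: measurable_walk_le.
exists (A0 `|` U1 `|` U2); split.
- by apply: measurableU => //; exact: measurableU.
- have -> : (delta = delta / 2 + delta / 4 + delta / 4)%R by field.
  apply: (le_trans (measureU2 _ _ _)) => //; first exact: measurableU.
  rewrite EFinD leeD//; last first.
    apply: (@le_trans _ _ (n.+1%:R * expR (- (s * (e / 3) * n%:R)))%:E).
      apply: probability_bigsetU_le => t _; last exact: tail.
      exact: measurable_walk_le.
    by rewrite lee_fin Hn2.
  apply: (le_trans (measureU2 _ _ _)) => //.
  rewrite EFinD leeD//.
    by apply: Hn1 => // t /andP[t0 _]; exact: law.
  apply: (@le_trans _ _ (n.+1%:R * expR (- (s * (e / 3) * n%:R)))%:E).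
    apply: probability_bigsetU_le => t _; last exact: tail.
    exact: measurable_walk_le.
  by rewrite lee_fin Hn2.
move=> w nA t tn.
have h0 : walk (X w) 0 n k < (n%:R * (Ir + e / 3))%:E.
  by rewrite ltNge; apply/negP => ?; apply: nA; left; left.
have h1 u : (u <= n)%N -> (- c)%:E <= walk (X w) 0 u k.
  move=> un; rewrite leNgt; apply/negP => /ltW hu; apply: nA; left; right.
  by rewrite /U1 -bigcup_mkord; exists u.
have h2 u : (u <= n)%N -> (- c)%:E <= walk (X w) u (n - u) k.
  move=> un; rewrite leNgt; apply/negP => /ltW hu; apply: nA; right.
  by rewrite /U2 -bigcup_mkord; exists u.
apply: le_lt_trans (cusum_le_walk h1 h2 tn) _.
have -> : (n%:R * (Ir + e) = n%:R * (Ir + e / 3) + (c + c))%R.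
  by rewrite /c; field.
by rewrite [ltRHS]EFinD lteD2rE.
Qed.


End CusumBounds.

(** * Change of measure *)

Section ChangeOfMeasure.
Context {R : realType} {K : nat} {d dE : measure_display}.
Context {Omega : measurableType d} {E : measurableType dE}.
Variables (lambda : {measure set E -> \bar R}) (f g : E -> R).
Hypotheses (densf : prob_density lambda f) (densg : prob_density lambda g).
Variables (N : {set 'I_K}) (X : Omega -> obs_path K E).
Hypothesis mX : forall t k, (1 <= t)%N -> k \in N ->
  measurable_fun [set: Omega] (fun w => X w t k).
Variables P Q : probability Omega R.
Hypothesis indP : mutually_independent P (honest_index N) (honest_obs X).
Hypothesis indQ : mutually_independent Q (honest_index N) (honest_obs X).
Variable Ir : R.
Hypothesis defI : Ir%:E = \int[lambda]_e (llr f g e * (g e)%:E).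
Variable k : 'I_K.
Hypothesis kN : k \in N.
Hypothesis lawP : forall t, (0 < t)%N -> has_density lambda X P f t k.
Hypothesis lawQ : forall t, (0 < t)%N -> has_density lambda X Q g t k.

Let mllr : measurable_fun [set: E] (llr f g).
Proof. exact: measurable_llr densf densg. Qed.
Let mf : measurable_fun [set: E] f. Proof. by case: densf. Qed.
Let f0 e : (0 <= f e)%R. Proof. by case: densf. Qed.
Let mg : measurable_fun [set: E] g. Proof. by case: densg. Qed.
Let g0 e : (0 <= g e)%R. Proof. by case: densg. Qed.
Let mobs i : honest_index N i -> measurable_fun [set: Omega] (honest_obs X i).
Proof. by case: i => t j [/= t1 jN]; exact: mX. Qed.
Let mexp := @measurable_expeR R.
Let e0 (y : \bar R) : 0 <= expeR y := expeR_ge0 y.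

Local Notation walk x a m k := (walk f g x a m k).

Let integral_obs_change t (psi : \bar R -> \bar R) : (0 < t)%N ->
  measurable_fun [set: \bar R] psi -> (forall y, 0 <= psi y) ->
  \int[P]_w (psi (llr f g (X w t k)) * expeR (llr f g (X w t k))) =
  \int[Q]_w psi (llr f g (X w t k)).
Proof.
move=> t0 mpsi psi0.
rewrite (integral_obs mX mf f0 t0 kN (lawP t0)
  (phi := fun e => psi (llr f g e) * expeR (llr f g e)))//; last 2 first.
- by apply: emeasurable_funM; [exact: measurableT_comp|exact: measurableT_comp mexp mllr].
- by move=> e; rewrite mule_ge0.
rewrite (integral_obs mX mg g0 t0 kN (lawQ t0) (phi := fun e => psi (llr f g e)))//.
  exact: (integral_change_of_density densf densg defI mpsi psi0).
exact: measurableT_comp.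
Qed.

Let step_indep (S : probability Omega R) a m (F : \bar R * \bar R -> \bar R) :
  mutually_independent S (honest_index N) (honest_obs X) ->
  measurable_fun [set: \bar R * \bar R] F -> (forall z, 0 <= F z) ->
  \int[S]_w F (walk (X w) a m k, llr f g (X w (a + m).+1 k)) =
  \int[S]_w \int[S]_w' F (walk (X w) a m k, llr f g (X w' (a + m).+1 k)).
Proof.
move=> indS mF F0.
have disj : sensor_block a (a + m) k `&`
    sensor_block (a + m).+1.-1 (a + m).+1 k = set0.
  apply/seteqP; split=> -[u j]//= [[/andP[_ t1] _] [/andP[t2 _] _]].
  by move: t1 t2 => /= t1 t2; lia.
apply: (coord_indep_integral mobs indS (sensor_block_honest kN)
  (sensor_block_honest kN) disj).
- exact: (@walk_coord_measurable _ _ _ _ _ _ _ _ _ densf densg X a m k).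
- exact: (@llr_coord_measurable _ _ _ _ _ _ _ _ _ densf densg X (a + m).+1 k _ (@measurable_id _ _ setT) isT).
- exact: mF.
- exact: F0.
Qed.

(** The exponential of the walk is the likelihood ratio of the observations of
    the sensor between times [a] and [a + m]; the induction splits off the last
    observation by independence. *)
Lemma integral_walk_change a m (phi : \bar R -> \bar R) :
  measurable_fun [set: \bar R] phi -> (forall y, 0 <= phi y) ->
  \int[P]_w (phi (walk (X w) a m k) * expeR (walk (X w) a m k)) =
  \int[Q]_w phi (walk (X w) a m k).
Proof.
elim: m phi => [|m IH] phi mphi phi0.
  under eq_integral do rewrite walk0 expeR0 mule1.
  under [RHS]eq_integral do rewrite walk0.
  by rewrite !integral_cst_probability.
have madd : measurable_fun [set: \bar R * \bar R] (fun z => z.1 + z.2).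
  by apply: emeasurable_funD; [exact: measurable_fst|exact: measurable_snd].
have mphiD : measurable_fun [set: \bar R * \bar R] (fun z => phi (z.1 + z.2)).
  exact: measurableT_comp.
pose F (z : \bar R * \bar R) := phi (z.1 + z.2) * (expeR z.1 * expeR z.2).
have mF : measurable_fun setT F.
  apply: emeasurable_funM => //; apply: emeasurable_funM.
    by apply: (measurableT_comp mexp); exact: measurable_fst.
  by apply: (measurableT_comp mexp); exact: measurable_snd.
have F0 z : 0 <= F z by rewrite mule_ge0// mule_ge0.
under eq_integral do rewrite walkS expeRD.
under [RHS]eq_integral do rewrite walkS.
rewrite [LHS](step_indep a m (F := F) indP mF F0).
rewrite [RHS](step_indep a m (F := fun z => phi (z.1 + z.2)) indQ)//.
have ml : measurable_fun setT (fun w => llr f g (X w (a + m).+1 k)).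
  by apply: (measurableT_comp mllr); exact: mX.
pose Phi x := \int[Q]_w' phi (x + llr f g (X w' (a + m).+1 k)).
have Phi0 x : 0 <= Phi x by apply: integral_ge0.
have mPhi : measurable_fun setT Phi.
  have := @measurable_fun_fubini_tonelli_F _ _ _ _ _ Q
    (fun z : \bar R * Omega => phi (z.1 + llr f g (X z.2 (a + m).+1 k))).
  apply => //; apply: (measurableT_comp mphi); apply: emeasurable_funD.
    exact: measurable_fst.
  by apply: (measurableT_comp ml); exact: measurable_snd.
rewrite -(IH Phi mPhi Phi0); apply: eq_integral => w _.
rewrite /F /=; set x := walk _ _ _ _.
have mpx : measurable_fun setT (fun y => phi (x + y)).
  by apply: (measurableT_comp mphi); apply: emeasurable_funD => //; exact: measurable_cst.
rewrite /Phi -(integral_obs_change (psi := fun y => phi (x + y)))// muleC.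
rewrite -ge0_integralZl//; last 2 first.
- apply: emeasurable_funM; first exact: measurableT_comp mpx ml.
  exact: measurableT_comp mexp ml.
- by move=> w' _; rewrite mule_ge0.
by apply: eq_integral => w' _; rewrite muleCA.
Qed.

(** On the event on the left the likelihood ratio is at most [expR c]. *)
Lemma walk_change_lower a m (h c : R) :
  (expR (- c))%:E *
    Q [set w | h%:E <= walk (X w) a m k <= c%:E] <=
  P [set w | h%:E <= walk (X w) a m k].
Proof.
have mS := measurable_sensor_walk densf densg mX a m kN.
pose S w := walk (X w) a m k.
pose J : set (\bar R) := [set y | h%:E <= y <= c%:E].
have mJ : measurable J.
  rewrite (_ : J = [set y | h%:E <= y] `&` [set y | y <= c%:E]); last first.
    by apply/seteqP; split=> y; rewrite /J/=; [move=> /andP[]|move=> [-> ->]].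
  by apply: measurableI; rewrite -[X in measurable X]setTI;
    [exact: emeasurable_fun_c_infty|exact: emeasurable_fun_infty_c].
have mSJ : measurable (S @^-1` J) by rewrite -[X in measurable X]setTI; exact: mS.
pose A := [set w | h%:E <= S w].
have mA : measurable A by rewrite -[A]setTI; exact: emeasurable_fun_c_infty.
pose phi y : \bar R := (\1_J y)%:E.
have mphi : measurable_fun setT phi by exact/measurable_EFinP.
have phi0 y : 0 <= phi y by rewrite lee_fin.
have QE : Q (S @^-1` J) = \int[Q]_w phi (S w).
  rewrite -[RHS]/(\int[Q]_w (\1_(S @^-1` J) w)%:E).
  by rewrite integral_indic// setIT.
have : Q (S @^-1` J) <= (expR c)%:E * P A.
  rewrite QE -(integral_walk_change a m mphi phi0).
  apply: (@le_trans _ _ (\int[P]_w ((expR c)%:E * (\1_A w)%:E))).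
    apply: ge0_le_integral => //.
    - by move=> w _; rewrite mule_ge0.
    - apply: emeasurable_funM; first exact: measurableT_comp mphi mS.
      exact: measurableT_comp mexp mS.
    - by apply: measurable_funeM; exact/measurable_EFinP.
    - move=> w _; rewrite /phi indicE; case: (boolP (S w \in J)) => [/set_mem SJ|_].
        move: SJ; rewrite /J /= => /andP[hS Sc].
        by rewrite mul1e indicE mem_set// mule1 -[leRHS]/(expeR c%:E) lee_expeR.
      by rewrite mul0e mule_ge0 ?lee_fin ?expR_ge0.
  have mI : measurable_fun setT (fun w => (\1_A w : R)%:E) by exact/measurable_EFinP.
  have ec0 : 0 <= (expR c)%:E by rewrite lee_fin expR_ge0.
  by rewrite ge0_integralZl// integral_indic// setIT.
move=> /(lee_wpmul2l (_ : 0 <= (expR (- c))%:E)); rewrite lee_fin expR_ge0 => /(_ isT).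
by rewrite muleA -EFinM -expRD addNr expR0 mul1e.
Qed.

End ChangeOfMeasure.

(** * Waiting for a good block *)

Section GeometricBlocks.
Context {R : realType} {d : measure_display} {Omega : measurableType d}.
Variable P : probability Omega R.

(** [D] is at most [n] times the number of [j] with [j * n < D]; sum the
    geometric series of their probabilities. *)
Lemma geometric_blocks (A : set Omega) (D : Omega -> \bar R) n (q : R) :
  measurable A -> measurable_fun [set: Omega] D -> (forall w, 0 <= D w) ->
  (0 < n)%N -> (0 <= q)%R -> (q < 1)%R ->
  (forall j, P (A `&` [set w | (j * n)%:R%:E < D w]) <= (q ^+ j)%:E * P A) ->
  \int[P]_(w in A) D w <= (n%:R / (1 - q))%:E * P A.
Proof.
move=> mA mD D0 n0 q0 q1 PD.
pose B j := A `&` [set w | (j * n)%:R%:E < D w].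
have mB j : measurable (B j).
  apply: measurableI => //; rewrite -[X in measurable X]setTI.
  exact: emeasurable_fun_o_infty.
pose F (j : nat) w : \bar R := n%:R%:E * (\1_(B j) w)%:E.
have F0 j w : 0 <= F j w by rewrite mule_ge0 ?lee_fin.
have mF j : measurable_fun setT (F j).
  by apply: measurable_funeM; exact/measurable_EFinP.
have DF w : A w -> D w <= \sum_(j <oo) F j w.
  move=> Aw.
  have part J : mine (D w) (J * n)%:R%:E <= \sum_(0 <= j < J) F j w.
    elim: J => [|J IH]; first by rewrite big_nil ge_min lexx orbT.
    rewrite big_nat_recr//=.
    have [DJ|DJ] := leP (D w) (J * n)%:R%:E.
      apply: (@le_trans _ _ (mine (D w) (J * n)%:R%:E)).
        by rewrite ge_min le_min lexx DJ.
      by rewrite (le_trans IH)// leeDl.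
    have -> : F J w = n%:R%:E by rewrite /F indicE mem_set ?mule1.
    apply: (@le_trans _ _ (J.+1 * n)%:R%:E); first by rewrite ge_min lexx orbT.
    rewrite mulSn addnC natrD EFinD leeD2r//.
    by move: IH; rewrite (min_idPr (ltW DJ)).
  set S := \sum_(j <oo) F j w.
  have SJ J : \sum_(0 <= j < J) F j w <= S.
    by apply: nneseries_lim_ge => j _ _.
  have [->|Sfin] := eqVneq S +oo; first exact: leey.
  have S0 : 0 <= S by apply: nneseries_ge0 => j _ _.
  have SF : S \is a fin_num by rewrite ge0_fin_numE// ltey.
  have := part (Num.bound (fine S)); have := SJ (Num.bound (fine S)).
  move=> /[swap] /le_trans /[apply]; rewrite ge_min => /orP[//|].
  rewrite -(fineK SF) lee_fin => h; exfalso.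
  have := archi_boundP (fine_ge0 S0); rewrite ltNge => /negP; apply.
  apply: le_trans h; rewrite ler_nat; case: (n) n0 => // n' _.
  by rewrite mulnS leq_addr.
apply: (@le_trans _ _ (\int[P]_w \sum_(j <oo) F j w)).
  rewrite integral_mkcond; apply: ge0_le_integral => //.
  - by move=> w _; rewrite /restrict; case: ifP.
  - by apply/(measurable_restrictT _ _).1 => //; exact: measurable_funTS.
  - exact: ge0_emeasurable_sum.
  - move=> w _; rewrite /restrict; case: ifPn => [/set_mem/DF//|_].
    by apply: nneseries_ge0 => j _ _.
rewrite integral_nneseries//.
have IF j : \int[P]_w F j w <= (n%:R * q ^+ j)%:E * P A.
  rewrite /F ge0_integralZl//; last exact/measurable_EFinP.
  rewrite integral_indic// setIT EFinM -muleA.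
  by rewrite lee_wpmul2l ?lee_fin//; exact: PD.
apply: lime_le; first by apply: is_cvg_nneseries => j _ _; exact: integral_ge0.
apply: nearW => J.
apply: (@le_trans _ _ (\sum_(0 <= j < J) (n%:R * q ^+ j)%:E * P A)).
  by apply: lee_sum => j _; exact: IF.
rewrite -ge0_sume_distrl; last by move=> j _; rewrite lee_fin mulr_ge0 ?exprn_ge0.
rewrite lee_wpmul2r// sumEFin lee_fin -mulr_sumr ler_wpM2l//.
rewrite -(@ler_pM2r _ (1 - q)%R) ?subr_gt0// mulVf ?gt_eqF ?subr_gt0//.
have : ((1 - q) * (\sum_(0 <= j < J) q ^+ j) = 1 - q ^+ J)%R.
  by rewrite big_mkord; have := subrX1 q J; lra.
by rewrite mulrC => ->; rewrite lerBlDr lerDl exprn_ge0.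
Qed.

End GeometricBlocks.

Section IndependentBlocks.
Context {R : realType} {K : nat} {d dE : measure_display}.
Context {Omega : measurableType d} {E : measurableType dE}.
Variables (N : {set 'I_K}) (X : Omega -> obs_path K E).
Hypothesis mX : forall t k, (1 <= t)%N -> k \in N ->
  measurable_fun [set: Omega] (fun w => X w t k).
Variable P : probability Omega R.
Hypothesis indX : mutually_independent P (honest_index N) (honest_obs X).

Let mobs i : honest_index N i -> measurable_fun [set: Omega] (honest_obs X i).
Proof. by case: i => t k [/= t1 kN]; exact: mX. Qed.

Local Notation sigma a b := <<s coord_events (honest_obs X) (times_in N a b) >>.

Lemma times_in_honest a b : times_in N a b `<=` honest_index N.
Proof. by move=> [t k] [/andP[/= ta _] kN]; split=> //=; exact: leq_trans ta. Qed.

Lemma sigma_times_measurable a b : sigma a b `<=` measurable.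
Proof. exact: (coord_sigma_measurable mobs (@times_in_honest a b)). Qed.

Lemma sigma_timesS a b b' : (b <= b')%N -> sigma a b `<=` sigma a b'.
Proof.
move=> bb'; apply: sub_sigma_algebra2.
move=> _ [i [D [[/andP[ia ib] iN] mD ->]]]; exists i, D; split=> //.
by split=> //; rewrite ia (leq_trans ib).
Qed.

(** Each block of [n] observations is independent of the past, so the
    probability that the first [j] blocks after time [a] are all bad decreases
    geometrically, whatever happened up to time [a]. *)
Lemma delay_le_blocks (A : set Omega) (D : Omega -> \bar R) a n (q : R)
    (Bad : nat -> set Omega) :
  sigma 0 a A -> measurable_fun [set: Omega] D -> (forall w, 0 <= D w) ->
  (0 < n)%N -> (q < 1)%R ->
  (forall j, sigma (a + j * n) (a + j.+1 * n) (Bad j)) ->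
  (forall j, P (Bad j) <= q%:E) ->
  (forall j w, ~ Bad j w -> D w <= (j.+1 * n)%:R%:E) ->
  \int[P]_(w in A) D w <= (n%:R / (1 - q))%:E * P A.
Proof.
move=> sA mD D0 n0 q1 sB Bq BD.
have q0 : (0 <= q)%R by rewrite -lee_fin (le_trans _ (Bq 0%N)).
have mA := sigma_times_measurable sA.
pose C j := A `&` \big[setI/setT]_(i < j) Bad i.
have sC j : sigma 0 (a + j * n) (C j).
  elim: j => [|j IH]; first by rewrite /C big_ord0 setIT mul0n addn0.
  rewrite /C big_ord_recr/= setIA -/(C j).
  pose W := g_sigma_algebraType (coord_events (honest_obs X) (times_in N 0 (a + j.+1 * n))).
  apply: (@measurableI _ W).
    by apply: sigma_timesS IH; rewrite leq_add2l leq_mul2r leqnSn orbT.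
  apply: sub_sigma_algebra2 (sB j).
  move=> _ [i [S [[/andP[ia ib] iN] mS ->]]]; exists i, S; split=> //.
  by split=> //; rewrite ib (leq_ltn_trans _ ia).
have PC j : P (C j) <= (q ^+ j)%:E * P A.
  elim: j => [|j IH]; first by rewrite /C big_ord0 setIT expr0 mul1e.
  rewrite /C big_ord_recr/= setIA -/(C j).
  have disj : times_in N 0 (a + j * n) `&` times_in N (a + j * n) (a + j.+1 * n) = set0.
    apply/seteqP; split=> -[t k]//= [[/andP[_ t1] _] [/andP[t2 _] _]].
    by move: t1 t2 => /= t1 t2; move: (leq_ltn_trans t1 t2); rewrite ltnn.
  rewrite (indep_sigma mobs indX (@times_in_honest _ _) (@times_in_honest _ _) disj (sC j) (sB j)).
  rewrite muleC exprS EFinM -muleA; apply: lee_pmul => //.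
apply: geometric_blocks => // j.
apply: le_trans (PC j).
apply: le_measure.
- rewrite inE; apply: measurableI => //; rewrite -[S in measurable S]setTI.
  exact: emeasurable_fun_o_infty.
- by rewrite inE; exact: sigma_times_measurable (sC j).
move=> w /= [Aw jD]; split=> //.
rewrite -bigcap_mkord => i /= ij; apply: contrapT => nB.
have := lt_le_trans jD (BD i w nB); rewrite lte_fin ltr_nat ltnNge.
by rewrite leq_mul2r ij orbT.
Qed.

End IndependentBlocks.


Lemma probability_seqU_le {R : realType} {d} {Omega : measurableType d}
    (P : probability Omega R) (I : eqType) (s : seq I) (A : I -> set Omega) (b : R) :
  (forall i, i \in s -> measurable (A i)) ->
  (forall i, i \in s -> P (A i) <= b%:E) ->
  P (\big[setU/set0]_(i <- s) A i) <= ((size s)%:R * b)%:E.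
Proof.
elim: s => [|i s IH] mA bA; first by rewrite big_nil measure0 mul0r.
have mAs : forall j, j \in s -> measurable (A j).
  by move=> j js; apply: mA; rewrite inE js orbT.
rewrite big_cons (le_trans (measureU2 _ _ _))//.
- by apply: mA; rewrite mem_head.
- by rewrite big_seq; apply: bigsetU_measurable => j; exact: mAs.
rewrite /= -natr1 mulrDl mul1r addrC EFinD leeD ?bA ?mem_head// IH// => j js.
by apply: bA; rewrite inE js orbT.
Qed.

(** Tested on the event that [Z] exceeds [c + e], the bound on the means forces
    this event to be null. *)
Lemma ess_sup_cond_expectation_le {R : realType} {d} {Omega : measurableType d}
    (P : probability Omega R) (F : set (set Omega)) (Y Z : Omega -> \bar R) (c : R) :
  (0 <= c)%R -> is_cond_expectation P F Y Z -> F `<=` measurable ->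
  (forall A, F A -> \int[P]_(w in A) Y w <= c%:E * P A) ->
  ess_sup P Z <= c%:E.
Proof.
move=> c0 [Z0 mZ ZY] Fm Yc; apply/lee_addgt0Pr => e e0.
pose A := Z @^-1` `](c + e)%:E, +oo[%classic.
have FA : F A by apply: mZ; exact: emeasurable_itv.
have mA := Fm _ FA.
have mZO : measurable_fun setT Z by move=> _ D mD; rewrite setTI; exact/Fm/mZ.
have ce0 : (0 <= c + e)%R by rewrite addr_ge0// ltW.
have : (c + e)%:E * P A <= c%:E * P A.
  apply: le_trans (Yc _ FA); rewrite -ZY// -integral_cst//.
  apply: ge0_le_integral => //.
  - exact: measurable_funTS.
  - by move=> w; rewrite /A/= in_itv/= andbT => /ltW.
rewrite -(fineK (fin_num_measure P _ mA)) -!EFinM lee_fin mulrDl gerDl => h.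
have PA0 : P A = 0.
  apply/eqP; rewrite -(fineK (fin_num_measure P _ mA)) eqe eq_le fine_ge0// andbT.
  by rewrite -(pmulr_rle0 _ e0).
rewrite -EFinD; apply/ess_supP; exists A; split=> // w /= /negP.
by rewrite -ltNge /A/= in_itv/= andbT.
Qed.

(** Otherwise [f < g] everywhere, although both have integral one. *)
Lemma exists_llr_le0 {R : realType} {dE} {E : measurableType dE}
    (lambda : {measure set E -> \bar R}) (f g : E -> R) :
  prob_density lambda f -> prob_density lambda g ->
  exists e, llr f g e <= 0.
Proof.
move=> densf densg; apply: contrapT => /forallNP H.
have [mf f0 If] := densf; have [mg g0 Ig] := densg.
have fg e : (f e < g e)%R.
  have /negP := H e; rewrite -ltNge (llrE densf densg).
  case: (leP (g e) 0%R) => // ge; case: (leP (f e) 0%R) => [fe _|fe].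
    exact: le_lt_trans ge.
  by rewrite lte_fin subr_gt0 ltr_ln.
have mgf : measurable_fun setT (fun e => (g e - f e)%:E).
  by apply/measurable_EFinP; exact: measurable_funB.
have gf0 e : 0 <= (g e - f e)%:E by rewrite lee_fin subr_ge0 ltW.
have : \int[lambda]_e ((g e - f e)%:E + (f e)%:E) = 1.
  by rewrite -Ig; apply: eq_integral => e _; rewrite -EFinD subrK.
rewrite ge0_integralD//; last 2 first.
- by move=> e _; rewrite lee_fin.
- exact/measurable_EFinP.
rewrite If => I0.
have {}I0 : \int[lambda]_e `|(g e - f e)%:E| = 0.
  under eq_integral do rewrite gee0_abs//.
  move: I0; case: (\int[lambda]_e _) => [r| |]//= [r1].
  by congr EFin; move: r1; lra.
have : \int[lambda]_e (f e)%:E = \int[lambda]_e (cst 0 e).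
  apply: ae_eq_integral => //; first exact/measurable_EFinP.
  have /(ae_eq_integral_abs _ measurableT mgf) := I0.
  by apply: filterS => e /(_ Logic.I)[] /eqP; rewrite subr_eq0 gt_eqF.
by rewrite If integral0 => -[/eqP]; rewrite oner_eq0.
Qed.

(** * Delay and false alarms of the low-sum rule *)

Section LowSumRule.
Context {R : realType} {K M : nat} {d dE : measure_display}.
Context {Omega : measurableType d} {E : measurableType dE}.
Variables (lambda : {measure set E -> \bar R}) (f g : E -> R).
Hypotheses (densf : prob_density lambda f) (densg : prob_density lambda g).
Variables (N B : {set 'I_K}) (X : Omega -> obs_path K E).
Hypothesis mX : forall t k, (1 <= t)%N -> k \in N ->
  measurable_fun [set: Omega] (fun w => X w t k).
Variables (Pinf : probability Omega R) (P : nat -> probability Omega R).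
Hypotheses (ltMK : (M < K)%N) (cardN : #|N| = (K - M)%N) (subBN : B \subset N).
Hypothesis lawPinf : honest_law lambda N X (fun _ _ => f) Pinf.
Hypothesis lawP : forall nu : nat, honest_law lambda N X
  (fun t k => if (k \in B) && (nu < t)%N then g else f) (P nu).
Variable Ir : R.
Hypothesis defI : Ir%:E = \int[lambda]_e (llr f g e * (g e)%:E).
Hypothesis Ir0 : (0 < Ir)%R.

Let mllr : measurable_fun [set: E] (llr f g).
Proof. exact: measurable_llr densf densg. Qed.

Let indinf : mutually_independent Pinf (honest_index N) (honest_obs X).
Proof. by case: lawPinf. Qed.

Let indP nu : mutually_independent (P nu) (honest_index N) (honest_obs X).
Proof. by case: (lawP nu). Qed.

Let densinf t k : (0 < t)%N -> k \in N -> has_density lambda X Pinf f t k.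
Proof. by move=> t0 kN D mD; case: lawPinf => /(_ t k t0 kN D mD). Qed.

Let denspost nu t k : (nu < t)%N -> k \in B -> has_density lambda X (P nu) g t k.
Proof.
move=> nut kB D mD; have kN := fintype.subsetP subBN k kB.
have [/(_ t k (leq_trans (ltn0Sn _) nut) kN D mD) -> _] := lawP nu.
by rewrite kB nut.
Qed.

Let denspre t k : (0 < t)%N -> k \in N -> k \notin B ->
  has_density lambda X (P 0) f t k.
Proof.
move=> t0 kN kB D mD.
by have [/(_ t k t0 kN D mD) -> _] := lawP 0; rewrite (negbTE kB).
Qed.

Local Notation T h := (low_sum_time f g [set: 'I_K]%SET (K - M) h).
Local Notation S h := (low_sum_time f g N (K - M) h).

Let cardNK : (#|N| <= K)%N. Proof. by rewrite cardN leq_subr. Qed.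

Let leKM : (K - M <= #|[set: 'I_K]%SET|)%N.
Proof. by rewrite cardsT card_ord leq_subr. Qed.

Let leKMN : (K - M <= #|N|)%N. Proof. by rewrite cardN. Qed.

Lemma measurable_attacked_time pi h : strategy N pi ->
  measurable_fun [set: Omega] (fun w => T h (attacked N pi (X w))).
Proof.
move=> spi.
apply: (@measurable_low_sum_time R K dE d E Omega f g
  (fun w => attacked N pi (X w)) mllr _ _ _ leKM) => k n _ t tn.
have mobs i : honest_index N i -> measurable_fun [set: Omega] (honest_obs X i).
  by case: i => u j [/= u0 jN]; exact: mX.
exact: (coord_measurable_fun mobs (@times_in_honest _ N 0 n)
  (@attacked_coord_measurable _ _ _ _ _ _ X pi t n k spi tn)).
Qed.

Lemma measurable_honest_time h :
  measurable_fun [set: Omega] (fun w => S h (X w)).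
Proof.
apply: (@measurable_low_sum_time R K dE d E Omega f g X mllr _ _ _ leKMN).
by move=> k n kN t /andP[t0 _]; exact: mX.
Qed.

Lemma low_sum_admissible (gamma h : R) :
  \int[Pinf]_w S h (X w) = gamma%:E -> admissible N X Pinf gamma (T h).
Proof.
move=> Sg; split; first by apply: low_sum_time_stopping => //; exact: leq_subr.
apply: le_ereal_inf_tmp => _ [pi spi <-]; rewrite -Sg.
apply: ge0_le_integral => //.
- by move=> w _; exact: low_sum_time_ge0.
- exact: measurable_honest_time.
- exact: measurable_attacked_time.
- by move=> w _; exact: attacked_low_sum_time_ge.
Qed.


Hypothesis MB : (M < #|B|)%N.

Let L : R := (#|B| - M)%:R.
Let L0 : (0 < L)%R. Proof. by rewrite ltr0n subn_gt0. Qed.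
Let LI0 : (0 < L * Ir)%R. Proof. exact: mulr_gt0. Qed.
Let K0 : (0 < K%:R :> R)%R.
Proof. by rewrite ltr0n (leq_ltn_trans _ ltMK). Qed.

Let measurable_walk_le a m k (c : R) : k \in N ->
  measurable [set w | walk f g (X w) a m k <= c%:E].
Proof.
move=> kN; rewrite -[A in measurable A]setTI; apply: emeasurable_fun_infty_c => //.
exact: (measurable_sensor_walk densf densg mX a m kN).
Qed.

Let sigma_walk a m k (D : set (\bar R)) : k \in N -> measurable D ->
  <<s coord_events (honest_obs X) (times_in N a (a + m)) >>
    ((fun w => walk f g (X w) a m k) @^-1` D).
Proof.
move=> kN mD.
have cw := @walk_coord_measurable _ _ _ _ _ _ _ _ _ densf densg X a m k.
have sub : sensor_block a (a + m) k `<=` times_in N a (a + m).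
  by move=> [t j] [/= tam ->]; split.
exact: (coord_measurableS sub cw).
Qed.

(** After the change every block of slightly more than [h / (L * Ir)]
    observations makes all sensors of [B] reach [h / L] simultaneously, with
    probability close to one; any [K - M] sensors contain [L] sensors of [B]. *)
Lemma worst_delay_upper (e : R) : (0 < e)%R -> (e < 1)%R ->
  exists2 C : R, (0 <= C)%R & forall h : R, (0 < h)%R ->
    worst_delay N X P (T h) <= ((h / (L * Ir) + C) / (1 - e))%:E.
Proof.
move=> e0 e1.
(* Blocks reach the rate [I1] except with probability [e / 2]; the two losses
   multiply to [(1 - e / 2) ^+ 2 >= 1 - e]. *)
pose I1 := (Ir * (1 - e / 2))%R.
have I10 : (0 < I1)%R by rewrite mulr_gt0//; lra.
pose u := (Ir * e / 4)%R.
have u0 : (0 < u)%R by rewrite divr_gt0 // mulr_gt0.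
have [s [s0 _ Is]] := exp_neg_llr_small densf densg defI u0 ltr01.
have su : (0 < s * u)%R by rewrite mulr_gt0.
have eK : (0 < e / 2 / K%:R)%R by rewrite !divr_gt0.
have [n0 Hn0] := linear_expN_small su eK.
exists (1 + n0%:R)%R; first by rewrite addr_ge0.
move=> h h0.
pose x := (h / (L * I1))%R.
have LI1 : (0 < L * I1)%R by exact: mulr_gt0.
have x0 : (0 <= x)%R := divr_ge0 (ltW h0) (ltW LI1).
have /andP[xn nx] := truncn_itv x0.
pose n := ((Num.truncn x).+1 + n0)%N.
have n_gt0 : (0 < n)%N by rewrite /n addSn.
have nle : (n%:R <= x + (1 + n0%:R))%R.
  by rewrite /n natrD -natr1; lra.
have hn : (h <= L * (n%:R * I1))%R.
  rewrite mulrCA -ler_pdivrMr //.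
  by rewrite (le_trans (ltW nx))// ler_nat leq_addr.
have q1 : (e / 2 < 1)%R by lra.
apply: ge_ereal_sup => _ [nu [pi [Z [spi cZ ->]]]].
pose D w := maxe (T h (attacked N pi (X w)) - nu%:R%:E) 0.
pose Bad j := \big[setU/set0]_(k <- enum B)
   [set w | walk f g (X w) (nu + j * n) n k <= (n%:R * I1)%:E].
have BN k : k \in enum B -> k \in N.
  by rewrite mem_enum; exact: (fintype.subsetP subBN).
have c0 : (0 <= n%:R / (1 - e / 2))%R by rewrite divr_ge0//; lra.
apply: (@le_trans _ _ (n%:R / (1 - e / 2))%:E).
  apply: (ess_sup_cond_expectation_le c0 cZ).
    apply: subset_trans (observed_history_coord spi) _.
    exact: (sigma_times_measurable mX).
  move=> A /(observed_history_coord spi) sA.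
  apply: (delay_le_blocks mX (indP nu) (a := nu) (Bad := Bad)) => //.
  - apply: measurable_maxe; last exact: measurable_cst.
    apply: emeasurable_funB; last exact: measurable_cst.
    exact: measurable_attacked_time.
  - by move=> w; rewrite le_max lexx orbT.
  - move=> j; pose W := g_sigma_algebraType (coord_events (honest_obs X)
      (times_in N (nu + j * n) (nu + j.+1 * n))).
    rewrite /Bad big_seq; apply: (@bigsetU_measurable _ W) => k /BN kN.
    have mI : measurable [set y : \bar R | y <= (n%:R * I1)%:E].
      by rewrite -[A' in measurable A']setTI; exact: emeasurable_fun_infty_c.
    by have := @sigma_walk (nu + j * n)%N n k _ kN mI; rewrite -addnA -mulSnr.
  - move=> j; apply: (@le_trans _ _ ((size (enum B))%:R * (e / 2 / K%:R))%:E).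
      apply: probability_seqU_le => k kB; first exact: measurable_walk_le (BN _ kB).
      have kN := BN _ kB; rewrite mem_enum in kB.
      apply: (le_trans (@walk_lower_tail _ _ _ _ _ _ _ _ _ densf densg _ _ mX _
        (indP nu) Ir s u (n%:R * I1)%R (nu + j * n)%N n k s0 kN _ Is)).
        move=> t /andP[ta _]; apply: denspost => //.
        exact: leq_ltn_trans (leq_addr _ _) ta.
      have -> : (s * (n%:R * I1 - n%:R * (Ir - u)) = - (s * u * n%:R))%R.
        by rewrite /I1 /u; field.
      rewrite lee_fin; apply: le_trans (Hn0 n (leq_addl _ _)).
      by rewrite ler_peMl ?expR_ge0// ler1n.
    rewrite lee_fin -cardE mulrCA ler_piMr//; first by rewrite divr_ge0// ltW.
    rewrite ler_pdivrMr// mul1r ler_nat.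
    exact: leq_trans (subset_leq_card subBN) cardNK.
  - move=> j w nB.
    rewrite ge_max lee_fin ler0n andbT leeBlDr// -EFinD -natrD addnC.
    apply/low_sum_time_leP; exists (nu + j.+1 * n)%N.
      by rewrite leqnn andbT addn_gt0 muln_gt0 n_gt0 orbT.
    apply: (@le_trans _ _ (L * (n%:R * I1))%:E); first by rewrite lee_fin.
    have -> : (K - M = #|[set: 'I_K]%SET| - M)%N by rewrite cardsT card_ord.
    apply: low_sum_ge_common.
    - exact: finset.subsetT.
    - exact: ltnW.
    - by rewrite mulr_ge0// ltW.
    - by move=> k; exact: cusum_ge0.
    move=> k kB; have kN := fintype.subsetP subBN k kB.
    rewrite (@eq_cusum _ _ _ f g _ (X w)); last first.
      by move=> t _; rewrite /attacked kN.
    rewrite mulSnr addnA; apply: le_trans (walk_le_cusum f g (X w) _ n k).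
    rewrite leNgt; apply/negP => /ltW hk; apply: nB.
    rewrite /Bad -bigcup_seq; exists k => //=.
    by rewrite mem_enum.
have xE : (x * (1 - e / 2) = h / (L * Ir))%R.
  by rewrite /x /I1; field; rewrite !gt_eqF//; lra.
rewrite -xE lee_fin ler_pdivrMr; last by lra.
rewrite mulrAC ler_pdivlMr; last by lra.
have C0 : (0 <= 1 + n0%:R :> R)%R by rewrite addr_ge0.
move: nle C0; set C := (1 + n0%:R)%R => nle C0.
apply: (@le_trans _ _ ((x + C) * (1 - e))%R); first by rewrite ler_pM2r//; lra.
have : (0 <= x * e ^+ 2)%R by rewrite mulr_ge0// sqr_ge0.
have : (0 <= C * e)%R by rewrite mulr_ge0// ltW.
rewrite expr2; lra.
Qed.


(** The exponent [1 - s] for small [s], by [integral_exp_llr_le]. *)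
Let exp_moment_below_one (s0 : R) : (0 < s0)%R -> (s0 <= 1)%R ->
  exists theta rho, [/\ (1 - s0 < theta)%R, (0 < theta)%R, (rho < 1)%R &
    \int[lambda]_e (expeR (theta%:E * llr f g e) * (f e)%:E) <= rho%:E].
Proof.
move=> s00 s01.
have I2 : (0 < Ir / 2)%R by rewrite divr_gt0.
have [s [sp ss0 Is]] := exp_neg_llr_small densf densg defI I2 s00.
exists (1 - s)%R, (expR (- (s * (Ir - Ir / 2))))%R; split.
- by rewrite ltrD2l ltrN2.
- by rewrite subr_gt0 (lt_le_trans ss0).
- by rewrite expR_lt1 oppr_lt0 mulr_gt0//; lra.
- apply: le_trans Is; apply: (integral_exp_llr_le densf densg sp).
  exact: lt_le_trans s01.
Qed.

Let history0 (C : set (obs_path K E)) : history [set: 'I_K]%SET 0 C ->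
  C = set0 \/ C = setT.
Proof.
apply: (@smallest_sub _ (sigma_algebra setT) _ [set C | C = set0 \/ C = setT]).
  split=> /=; first by left.
    by move=> A [->|->]; rewrite ?setTD ?setC0 ?setCT; [right|left].
  move=> F FE; have [[n Fn]|nF] := pselect (exists n, F n = setT).
    by right; apply/seteqP; split=> // w _; exists n => //; rewrite Fn.
  left; apply/seteqP; split=> // w [n _ Fnw].
  by case: (FE n) => Fn; [rewrite -Fn|case: nF; exists n].
by move=> C1 [t [k [D [/andP[t1 t0] _ _ _]]]]; have := leq_trans t1 t0.
Qed.

Lemma constant_strategy (e0 : E) :
  strategy N (fun (t : nat) (x : obs_path K E) (k : 'I_K) => e0).
Proof.
move=> t k _ _; split=> // D mD.
pose W := g_sigma_algebraType [set C | exists s j (D : set E),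
      [/\ (1 <= s <= t)%N, j \in N, measurable D &
          C = [set x : nat -> 'I_K -> E | D (x s j)]]].
have [De|De] := pselect (D e0).
  rewrite (_ : mkset _ = setT); last by apply/seteqP; split.
  exact: (@measurableT _ W).
rewrite (_ : mkset _ = set0); last by apply/seteqP; split.
exact: (@measurable0 _ W).
Qed.

(** At time zero nothing has been observed, so the conditional delay is the
    expected alarm time, and an adversary may report any fixed value. *)
Lemma worst_delay_ge_mean h e0 :
  \int[P 0]_w T h (attacked N (fun _ _ _ => e0) (X w)) <=
  worst_delay N X P (T h).
Proof.
set pi : nat -> obs_path K E -> 'I_K -> E := fun _ _ _ => e0.
have spi : strategy N pi by exact: constant_strategy.
have T0 w : 0 <= T h (attacked N pi (X w)) by exact: low_sum_time_ge0.
have mT := measurable_attacked_time h spi.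
set m := \int[P 0]_w _.
apply: ereal_sup_ubound; exists 0%N, pi, (fun=> m); split=> //.
- split.
  + by move=> _; exact: integral_ge0.
  + move=> D mD; have [Dm|Dm] := pselect (D m).
      exists setT; last by apply/seteqP; split.
      by rewrite -(setD0 setT); apply: sigma_algebraCD; exact: sigma_algebra0.
    exists set0; first exact: sigma_algebra0.
    by apply/seteqP; split=> // w [].
  + move=> A [C hC <-]; rewrite setTI; have [->|->] := history0 hC.
      by rewrite preimage_set0 !integral_set0.
    rewrite preimage_setT integral_cst_probability.
    by apply: eq_integral => w _; rewrite sube0 max_l.
- apply/esym/ess_sup_cst; rewrite [X in 0 < X](_ : _ = 1) ?lte01//.
  exact: probability_setT.
Qed.

(** Linear growth at the rates [Ir] on [B] and [0] on the other honest sensors,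
    simultaneously for all of them. *)
Let lln_sensors (e delta : R) : (0 < e)%R -> (0 < delta)%R ->
  exists n0, forall n, (n0 <= n)%N ->
    exists A, [/\ measurable A, P 0 A <= delta%:E & forall w, ~ A w ->
      forall k t, k \in N -> (t <= n)%N ->
      cusum f g (X w) t k <= (n%:R * ((if k \in B then Ir else 0) + e))%:E].
Proof.
move=> e0 delta0.
have dK : (0 < delta / K%:R)%R by rewrite divr_gt0.
have [theta [rho [_ t0 r1 Irho]]] := exp_moment_below_one ltr01 (lexx _).
have [n1 Hn1] := cusum_after_change_le densf densg mX (indP 0) defI Ir0 e0 dK.
have [n2 Hn2] := cusum_before_change_le densf densg mX (indP 0) t0 r1 Irho e0 dK.
exists (maxn n1 n2) => n; rewrite geq_max => /andP[n1n n2n].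
have /choice[A HA] : forall k, exists A : set Omega, k \in N ->
    [/\ measurable A, P 0 A <= (delta / K%:R)%:E & forall w, ~ A w ->
      forall t, (t <= n)%N ->
      cusum f g (X w) t k <= (n%:R * ((if k \in B then Ir else 0) + e))%:E].
  move=> k; have [kN|kN] := boolP (k \in N); last by exists set0.
  have [kB|kB] := boolP (k \in B).
    have [A [mA PA hA]] := Hn1 n n1n k kN (fun t t0 => @denspost 0%N t k t0 kB).
    by exists A => _; split=> // w nA t tn; apply/ltW; exact: hA.
  have [A [mA PA hA]] := Hn2 n n2n k kN (fun t t0 => denspre t0 kN kB).
  by exists A => _; split=> // w nA t tn; rewrite add0r; apply/ltW; exact: hA.
exists (\big[setU/set0]_(k <- enum N) A k); split.
- rewrite big_seq; apply: bigsetU_measurable => k; rewrite mem_enum => kN.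
  by have [] := HA k kN.
- apply: (@le_trans _ _ ((size (enum N))%:R * (delta / K%:R))%:E).
    by apply: probability_seqU_le => k; rewrite mem_enum => /HA[].
  rewrite lee_fin -cardE mulrCA ler_piMr ?(ltW delta0)//.
  by rewrite ler_pdivrMr// mul1r ler_nat.
- move=> w nA k t kN tn; have [_ _] := HA k kN; apply => //.
  by move=> Aw; apply: nA; rewrite -bigcup_seq; exists k => //=; rewrite mem_enum.
Qed.

(** If the corrupt sensors report a value with nonpositive log-likelihood
    ratio, their statistics vanish and the sum of the [K - M] lowest ones is at
    most the sum over the honest sensors outside [M] elements of [B]; of these
    only [L] have a positive drift. *)
Lemma worst_delay_lower (e : R) : (0 < e)%R -> (e < 1)%R ->
  exists2 C : R, (0 <= C)%R & forall h : R, (0 < h)%R ->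
    ((1 - e) * (h / (L * Ir)) - C)%:E <= worst_delay N X P (T h).
Proof.
move=> e0 e1.
have [z zle] := exists_llr_le0 densf densg.
pose u := (e / 2)%R.
have u0 : (0 < u)%R by rewrite divr_gt0.
have v0 : (0 < L * Ir * u / (2 * K%:R))%R by rewrite divr_gt0// ?mulr_gt0.
have [n0 Hn0] := lln_sensors v0 u0.
exists (1 + n0%:R)%R; first by rewrite addr_ge0.
move=> h h0; apply: le_trans (worst_delay_ge_mean h z).
set pi : nat -> obs_path K E -> 'I_K -> E := fun _ _ _ => z.
have T0 w : 0 <= T h (attacked N pi (X w)) by exact: low_sum_time_ge0.
(* Up to time [truncn x] the sum stays below [h] except with probability [u];
   the two losses combine to [(1 - u) / (1 + u) >= 1 - e]. *)
pose x := (h / (L * Ir * (1 + u)))%R.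
have x0 : (0 <= x)%R by rewrite divr_ge0 ?ltW// mulr_gt0//; lra.
have /andP[nx xn] := truncn_itv x0; set n := Num.truncn x in nx xn.
have xE : (h / (L * Ir) = x * (1 + u))%R.
  by rewrite /x; field; rewrite !gt_eqF//; lra.
have ux : ((1 - e) * (x * (1 + u)) <= (1 - u) * x)%R.
  have : (0 <= x * u ^+ 2)%R by rewrite mulr_ge0// sqr_ge0.
  have : (0 <= x * u)%R by rewrite mulr_ge0// ltW.
  by rewrite expr2 /u; nra.
have x_gt0 : (0 < x)%R by rewrite divr_gt0// mulr_gt0//; lra.
have hE : (h = x * (L * Ir * (1 + u)))%R.
  by rewrite /x divfK// gt_eqF// mulr_gt0//; lra.
rewrite xE.
have [nn0|n0n] := ltnP n n0.
  apply: (@le_trans _ _ 0); last exact: integral_ge0.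
  rewrite lee_fin subr_le0; apply: le_trans ux _.
  have : (n.+1%:R <= n0%:R :> R)%R by rewrite ler_nat.
  have : (0 <= x * u)%R by rewrite mulr_ge0// ltW.
  by lra.
have [A [mA PA hA]] := Hn0 n n0n.
have Tn w : ~ A w -> n%:R%:E <= T h (attacked N pi (X w)).
  move=> nA; rewrite leNgt; apply/negP => Tlt.
  have [Ty|[m Tm]] := low_sum_time_natP f g [set: 'I_K]%SET (K - M) h (attacked N pi (X w)).
    by move: Tlt; rewrite Ty.
  move: Tlt; rewrite Tm lte_fin ltr_nat => mn.
  have /low_sum_time_leP[t /andP[t0 tm]] :
      T h (attacked N pi (X w)) <= m%:R%:E by rewrite Tm.
  apply/negP; rewrite -ltNge.
  have tn : (t <= n)%N by rewrite (leq_trans tm)// ltnW.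
  (* Any family of values serves to select [M] elements of [B]. *)
  have [J1 [J1B cJ1 _]] := low_sum_attained (fun=> 0 : \bar R) (ltnW MB).
  pose J := (N :\: J1) :|: ~: N.
  have J1N := fintype.subset_trans J1B subBN.
  have cJ : #|J| = (K - M)%N.
    rewrite cardsU (_ : (N :\: J1) :&: ~: N = finset.set0); last first.
      by apply/setP => k; rewrite !inE; case: (k \in N); rewrite ?andbF.
    rewrite cards0 subn0 cardsD (finset.setIidPr J1N) cJ1.
    have := cardsC N; rewrite card_ord cardN; have := ltMK.
    have : (M <= #|N|)%N by rewrite -cJ1 subset_leq_card.
    rewrite cardN; clear; move: #|_| => c; lia.
  apply: le_lt_trans (low_sum_le _ (finset.subsetT J) cJ) _.
  set v := (L * Ir * u / (2 * K%:R))%R in v0 hA.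
  have n_ge0 : (0 <= n%:R :> R)%R by [].
  apply: (@le_lt_trans _ _ (\sum_(k in J)
      ((if k \in B then n%:R * Ir else 0) + n%:R * v)%:E)).
    apply: lee_sum => k kJ; have [kN|kN] := boolP (k \in N).
      rewrite (@eq_cusum _ _ _ f g _ (X w)); last first.
        by move=> ? _; rewrite /attacked kN.
      apply: le_trans (hA w nA k t kN tn) _.
      by rewrite lee_fin mulrDr; case: (k \in B); rewrite ?mulr0.
    rewrite cusum_eq0; last by move=> ? _; rewrite /attacked (negbTE kN).
    have nv0 : (0 <= n%:R * v)%R := mulr_ge0 n_ge0 (ltW v0).
    have nI0 : (0 <= n%:R * Ir)%R := mulr_ge0 n_ge0 (ltW Ir0).
    by rewrite lee_fin addr_ge0//; case: (k \in B).
  rewrite sumEFin lte_fin big_split/= sumr_const cJ -big_mkcondr/=.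
  rewrite (eq_bigl (mem (B :\: J1))); last first.
    move=> k; rewrite !inE; case: (boolP (k \in B)) => [kB|]; rewrite ?andbF//.
    by rewrite (fintype.subsetP subBN k kB)/= orbF !andbT.
  rewrite sumr_const cardsD (finset.setIidPr J1B) cJ1.
  rewrite -[X in (X + _ < _)%R]mulr_natl -[X in (_ + X < _)%R]mulr_natl -/L.
  have KM : ((K - M)%:R <= K%:R :> R)%R by rewrite ler_nat leq_subr.
  apply: (@le_lt_trans _ _ (n%:R * (L * Ir + K%:R * v))%R).
    have : (0 <= n%:R * v)%R by rewrite mulr_ge0// ltW.
    by move: KM; nra.
  have -> : (K%:R * v = L * Ir * (u / 2))%R by rewrite /v; field; rewrite gt_eqF.
  rewrite hE; apply: (@le_lt_trans _ _ (x * (L * Ir + L * Ir * (u / 2)))%R).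
    have LIu : (0 <= L * Ir * (u / 2))%R by rewrite mulr_ge0 ?(ltW LI0)// divr_ge0// ltW.
    by apply: ler_wpM2r => //; apply: addr_ge0 => //; exact: ltW.
  by rewrite ltr_pM2l// -[X in (X + _ < _)%R]mulr1 -mulrDr ltr_pM2l//; lra.
have mAc : measurable (~` A) by exact: measurableC.
have n_ge0 : (0 <= n%:R :> R)%R by [].
have mT := measurable_attacked_time h (constant_strategy z).
have := measure_le_integral (P 0) n_ge0 mAc mT T0 Tn; apply: le_trans.
apply: (@le_trans _ _ (n%:R%:E * (1 - P 0 A))); last first.
  by rewrite -probability_setC.
move: PA.
rewrite -(fineK (fin_num_measure (P 0) _ mA)) lee_fin; set p := fine _ => pu.
rewrite -EFinB -EFinM lee_fin.
have : (n%:R * (1 - u) <= n%:R * (1 - p))%R by rewrite ler_wpM2l//; lra.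
have u1 : (u < 1)%R by rewrite /u; lra.
have : ((1 - u) * x <= (1 - u) * (n%:R + 1))%R.
  by rewrite ler_wpM2l ?subr_ge0 ?(ltW u1)// natr1 ltW.
have : (0 <= n0%:R :> R)%R by [].
by move: ux; lra.
Qed.


(** Under no change the sum of the honest statistics has exponential tails,
    uniformly in time, of rates [theta] arbitrarily close to one, so it takes a
    time of order at least [expR (theta * h)] to reach [h]. *)
Lemma calibrated_threshold_upper (e : R) : (0 < e)%R -> (e < 1)%R ->
  exists C : R, forall gamma h : R, (1 <= gamma)%R -> (0 < h)%R ->
    \int[Pinf]_w S h (X w) = gamma%:E -> ((1 - e) * h <= ln gamma + C)%R.
Proof.
move=> e0 e1.
have [theta [rho [te t0 r1 Irho]]] := exp_moment_below_one e0 (ltW e1).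
have r0 : (0 < 1 - rho)%R by rewrite subr_gt0.
pose D := ((1 - rho)^-1 ^+ #|N|)%R.
have D0 : (0 < D)%R by rewrite exprn_gt0// invr_gt0.
exists (ln (6 * D)) => gamma h g1 h0 IS.
(* The union bound over the first [truncn x] times is at most [1 / 2]. *)
pose x := (expR (theta * h) / (2 * D))%R.
have x0 : (0 <= x)%R by rewrite divr_ge0 ?expR_ge0// ltW// mulr_gt0.
have /andP[nx xn] := truncn_itv x0; set n := Num.truncn x in nx xn.
pose A := [set w | S h (X w) <= n%:R%:E].
have mS := measurable_honest_time h.
have mA : measurable A by rewrite -[A]setTI; exact: emeasurable_fun_infty_c.
have mAc : measurable (~` A) by exact: measurableC.
have PA : Pinf A <= (1 / 2)%:E.
  apply: (@le_trans _ _ (n%:R * (D * expR (- (theta * h))))%:E); last first.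
    rewrite lee_fin expRN mulrA ler_pdivrMr ?expR_gt0//.
    rewrite -ler_pdivlMr// (le_trans nx)// /x le_eqVlt; apply/orP; left; apply/eqP.
    by field; rewrite gt_eqF.
  pose F t := [set w | h%:E <= \sum_(k in N) cusum f g (X w) t.+1 k].
  have mF t : measurable (F t).
    rewrite -[F t]setTI; apply: emeasurable_fun_c_infty => //.
    under eq_fun do rewrite big_mkcond.
    apply: emeasurable_sum => k; case: (boolP (k \in N)) => kN; last exact: measurable_cst.
    exact: (measurable_sensor_cusum densf densg mX).
  have FP t : Pinf (F t) <= (D * expR (- (theta * h)))%:E.
    apply: (sum_cusum_before_change_tail densf densg mX indinf t0 r1 Irho t.+1 h).
    by move=> u k kN u0; exact: densinf.
  apply: le_trans (probability_bigsetU_le (n := n) (fun t _ => mF t) (fun t _ => FP t)).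
  apply: le_measure; rewrite ?inE//.
    by apply: bigsetU_measurable => t _; exact: mF.
  move=> w /low_sum_time_leP[t /andP[]]; case: t => // t _ tn ht.
  rewrite -bigcup_mkord; exists t => //.
  by rewrite /F/= -low_sum_full cardN.
have nS w : ~ A w -> n%:R%:E <= S h (X w) by move=> /negP; rewrite -ltNge => /ltW.
have n_ge0 : (0 <= n%:R :> R)%R by [].
have S0 w : 0 <= S h (X w) by exact: low_sum_time_ge0.
have := measure_le_integral Pinf n_ge0 mAc mS S0 nS.
rewrite IS => H.
have : n%:R%:E * (1 - Pinf A) <= gamma%:E by rewrite -probability_setC.
move: PA; rewrite -(fineK (fin_num_measure Pinf _ mA)) lee_fin; set p := fine _ => p2.
rewrite -EFinB -EFinM lee_fin => np.
have n2 : (n%:R <= 2 * gamma)%R.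
  have : (n%:R * (1 / 2) <= n%:R * (1 - p))%R by rewrite ler_wpM2l//; lra.
  by lra.
have xg : (x <= 3 * gamma)%R.
  by move: xn; rewrite -natr1; lra.
have g0 : (0 < gamma)%R by lra.
rewrite -lnM ?posrE ?mulr_gt0//.
apply: (@le_trans _ _ (theta * h)%R); first by rewrite ler_pM2r// ltW.
rewrite -[leLHS]expRK ler_ln ?posrE ?expR_gt0 ?mulr_gt0//.
by move: xg; rewrite /x ler_pdivrMr ?mulr_gt0//; lra.
Qed.

(** A block of slightly more than [h / Ir] observations takes a single sensor to
    [h] with probability at least [expR (- c) / 2] for some [c] close to [h]:
    under the changed law this is typical, with a likelihood ratio of at most
    [expR c]. So the alarm comes within about [2 * expR c] blocks on average. *)
Lemma calibrated_threshold_lower (e : R) : (0 < e)%R -> (e < 1)%R ->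
  exists C : R, forall gamma h : R, (1 <= gamma)%R -> (0 < h)%R ->
    \int[Pinf]_w S h (X w) = gamma%:E -> ((1 - e) * ln gamma <= h + C)%R.
Proof.
move=> e0 e1.
have [k kB] : exists k, k \in B.
  by apply/set0Pn; rewrite -card_gt0 (leq_ltn_trans _ MB).
have kN := fintype.subsetP subBN k kB.
pose u := (Ir * e / 4)%R.
have u0 : (0 < u)%R by rewrite divr_gt0// mulr_gt0.
have u2 : (0 < u / 2)%R by rewrite divr_gt0.
have I1 : (0 < Ir - u)%R.
  have -> : (Ir - u = Ir * (1 - e / 4))%R by rewrite /u; field.
  by rewrite mulr_gt0//; lra.
have q4 : (0 < 1 / 4 :> R)%R by rewrite divr_gt0.
have [s [s0 _ Is]] := exp_neg_llr_small densf densg defI u2 ltr01.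
have su : (0 < s * (u / 2))%R by rewrite mulr_gt0.
have [n1 Hn1] := linear_expN_small su q4.
have [n2 Hn2] := walk_upper_tail densf densg mX (indP 0) defI Ir0 u0 q4.
pose n0 := maxn n1 n2.
exists ((1 - e) * ((1 + n0%:R) * (Ir + 2 * u) + ln (2 / u)))%R => gamma h g1 h0 IS.
pose x := (h / (Ir - u))%R.
have x0 : (0 <= x)%R := divr_ge0 (ltW h0) (ltW I1).
have /andP[xn nx] := truncn_itv x0.
pose n := ((Num.truncn x).+1 + n0)%N.
have n_gt0 : (0 < n)%N by rewrite /n addSn.
have nR0 : (0 < n%:R :> R)%R by rewrite ltr0n.
have nle : (n%:R <= x + (1 + n0%:R))%R by rewrite /n natrD -natr1; lra.
have hn : (h <= n%:R * (Ir - u))%R.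
  rewrite -ler_pdivrMr// (le_trans (ltW nx))// ler_nat leq_addr//.
pose c := (n%:R * (Ir + u))%R.
pose q := (1 - expR (- c) / 2)%R.
have ec0 := expR_gt0 (- c).
have q1 : (q < 1)%R by rewrite /q; lra.
pose Good j := [set w | h%:E <= walk f g (X w) (j * n) n k].
have mGood j : measurable (Good j).
  rewrite -[Good j]setTI; apply: emeasurable_fun_c_infty => //.
  exact: (measurable_sensor_walk densf densg mX _ _ kN).
have typical j : (1 / 2)%:E <=
    P 0 [set w | h%:E <= walk f g (X w) (j * n) n k <= c%:E].
  pose A1 := [set w | walk f g (X w) (j * n) n k <= (n%:R * (Ir - u))%:E].
  pose A2 := [set w | c%:E <= walk f g (X w) (j * n) n k].
  have mA1 : measurable A1 by exact: measurable_walk_le.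
  have mA2 : measurable A2.
    rewrite -[A2]setTI; apply: emeasurable_fun_c_infty => //.
    exact: (measurable_sensor_walk densf densg mX _ _ kN).
  have law t : (j * n < t <= j * n + n)%N -> has_density lambda X (P 0) g t k.
    by move=> /andP[jt _]; apply: denspost => //; exact: leq_ltn_trans jt.
  have PA1 : P 0 A1 <= (1 / 4)%:E.
    apply: (le_trans (@walk_lower_tail _ _ _ _ _ _ _ _ _ densf densg _ _ mX _
        (indP 0) Ir s (u / 2)%R (n%:R * (Ir - u))%R (j * n)%N n k s0 kN law Is)).
    have -> : (s * (n%:R * (Ir - u) - n%:R * (Ir - u / 2)) = - (s * (u / 2) * n%:R))%R.
      by field.
    rewrite lee_fin; apply: le_trans (Hn1 n _); last first.
      by rewrite (leq_trans (leq_maxl _ _) (leq_addl _ _)).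
    by rewrite ler_peMl ?expR_ge0// ler1n.
  have PA2 : P 0 A2 <= (1 / 4)%:E.
    by apply: Hn2 => //; rewrite (leq_trans (leq_maxr _ _) (leq_addl _ _)).
  have mA : measurable (A1 `|` A2) by exact: measurableU.
  have PA : P 0 (A1 `|` A2) <= (1 / 2)%:E.
    apply: (le_trans (measureU2 _ _ _)) => //.
    have -> : (1 / 2 = 1 / 4 + 1 / 4 :> R)%R by field.
    by rewrite EFinD leeD.
  apply: (@le_trans _ _ (1 - P 0 (A1 `|` A2))).
    move: PA; rewrite -(fineK (fin_num_measure (P 0) _ mA)) lee_fin => ?.
    by rewrite -EFinB lee_fin; lra.
  rewrite -probability_setC//; apply: le_measure.
  - by rewrite inE; exact: measurableC.
  - rewrite inE (_ : mkset _ = Good j `&` [set w | walk f g (X w) (j * n) n k <= c%:E]).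
      by apply: measurableI => //; exact: measurable_walk_le.
    by apply/seteqP; split=> w; rewrite /Good/=; [move=> /andP[]|move=> [-> ->]].
  move=> w /= /not_orP[n1w n2w]; apply/andP; split; last first.
    by apply: ltW; rewrite ltNge; apply/negP.
  apply: (@le_trans _ _ (n%:R * (Ir - u))%:E); first by rewrite lee_fin.
  by apply: ltW; rewrite ltNge; apply/negP.
have PGood j : (expR (- c) / 2)%:E <= Pinf (Good j).
  have := @walk_change_lower _ _ _ _ _ _ _ _ _ densf densg N X mX Pinf (P 0)
    indinf (indP 0) Ir defI k kN (fun t t0 => densinf t0 kN)
    (fun t t0 => @denspost 0%N t k t0 kB) (j * n)%N n h c.
  move=> H; apply: (le_trans _ H); rewrite EFinM lee_pmul2l//.
  by have := typical j; rewrite div1r.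
have : \int[Pinf]_(w in setT) S h (X w) <= (n%:R / (1 - q))%:E * Pinf setT.
  apply: (delay_le_blocks mX indinf (a := 0%N) (Bad := fun j => ~` Good j)) => //.
  - exact: (@measurableT _ (g_sigma_algebraType
      (coord_events (honest_obs X) (times_in N 0 0)))).
  - exact: measurable_honest_time.
  - by move=> w; exact: low_sum_time_ge0.
  - move=> j; have mI : measurable (~` [set y : \bar R | h%:E <= y]).
      apply: measurableC; rewrite -[A' in measurable A']setTI.
      exact: emeasurable_fun_c_infty.
    by have := @sigma_walk (j * n)%N n k _ kN mI; rewrite -mulSnr.
  - by move=> j; rewrite probability_setC// /q EFinB leeB.
  move=> j w /contrapT Gw; apply/low_sum_time_leP; exists (j.+1 * n)%N.
    by rewrite leqnn andbT muln_gt0 n_gt0.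
  apply: (le_trans Gw); apply: le_trans (walk_le_cusum _ _ _ _ _ _) _.
  rewrite -cardN low_sum_full mulSnr (bigD1 k)//= leeDl// sume_ge0// => i _.
  exact: cusum_ge0.
rewrite IS (_ : Pinf setT = 1); last exact: probability_setT.
rewrite mule1 lee_fin (_ : n%:R / (1 - q) = 2 * n%:R * expR c)%R; last first.
  by rewrite /q expRN; field; rewrite gt_eqF ?expR_gt0//; lra.
move=> gn; have g0 : (0 < gamma)%R by lra.
have lg : (ln gamma <= n%:R * (Ir + 2 * u) + ln (2 / u))%R.
  have un0 : (0 < u * n%:R)%R by rewrite mulr_gt0.
  apply: (@le_trans _ _ (ln (2 * n%:R * expR c))).
    by rewrite ler_ln ?posrE// !mulr_gt0 ?expR_gt0.
  have -> : (2 * n%:R = (2 / u) * (u * n%:R))%R by field; rewrite gt_eqF.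
  have du0 : (0 < 2 / u)%R by rewrite divr_gt0.
  rewrite lnM ?posrE ?expR_gt0//; last exact: mulr_gt0.
  rewrite lnM ?posrE// expRK.
  have := ln_sublinear un0; rewrite /c; lra.
have xh : (x * (Ir - u) = h)%R by rewrite /x divfK// gt_eqF.
have hu : ((1 - e) * (x * (Ir + 2 * u)) <= h)%R.
  rewrite -xh mulrCA ler_wpM2l// /u.
  by have : (0 <= Ir * e)%R; [rewrite mulr_ge0 ?ltW|nra].
apply: (@le_trans _ _ ((1 - e) * (n%:R * (Ir + 2 * u) + ln (2 / u)))%R).
  by rewrite ler_pM2l//; lra.
apply: (@le_trans _ _ ((1 - e) * ((x + (1 + n0%:R)) * (Ir + 2 * u) + ln (2 / u)))%R).
  rewrite ler_pM2l; last lra.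
  by rewrite lerD2r ler_pM2r//; lra.
by move: hu; lra.
Qed.

End LowSumRule.

(** * Asymptotics *)

Lemma cvg_ereal_to1 {R : realType} {T : Type} (F : set_system T)
    (FF : Filter F) (u : T -> \bar R) :
  (forall eta : R, (0 < eta)%R ->
    \forall x \near F, (1 - eta)%:E <= u x <= (1 + eta)%:E) ->
  u x @[x --> F] --> 1.
Proof.
move=> H.
have fin : \forall x \near F, u x \is a fin_num.
  apply: filterS (H 1%R ltr01) => x /andP[l1 l2].
  by rewrite fin_numE gt_eqF ?lt_eqF// ?(le_lt_trans l2) ?ltry// (lt_le_trans _ l1)// ltNyr.
apply: (cvg_EFin fin); apply/cvgrPdist_le => eta eta0.
have := H eta eta0; move: fin; apply: filterS2 => x xf /andP[].
rewrite /= -{1 2}(fineK xf) !lee_fin => l1 l2.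
by rewrite ler_norml; apply/andP; split; lra.
Qed.

Section SqueezeRatio.
Context {R : realType}.
Local Open Scope ring_scope.

Lemma ratio_upper (e C1 C3 a h x : R) : 0 < e -> e <= 1 / 8 -> 0 <= C1 ->
  0 < a -> 0 < x -> C3 + C1 * a <= e * x -> (1 - e) * h <= x + C3 ->
  (h / a + C1) / (1 - e) * (a / x) <= 1 + 8 * e.
Proof.
move=> e0 e8 C10 a0 x0 Cx hx.
have e1 : 0 < 1 - e by lra.
have -> : (h / a + C1) / (1 - e) * (a / x) = (h + C1 * a) / ((1 - e) * x).
  by field; rewrite !gt_eqF.
rewrite ler_pdivrMr ?mulr_gt0//.
rewrite -(ler_pM2l e1).
have Ca : 0 <= C1 * a by rewrite mulr_ge0// ltW.
have s1 : (1 - e) * (h + C1 * a) <= (1 + e) * x by nra.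
apply: le_trans s1 _.
have -> : (1 - e) * ((1 + 8 * e) * ((1 - e) * x)) =
    (1 - e) * (1 - e) * (1 + 8 * e) * x by ring.
rewrite ler_pM2r//.
have e20 : 0 <= e ^+ 2 by rewrite sqr_ge0.
have e2 : e ^+ 2 <= e / 8 by rewrite expr2; nra.
have -> : (1 - e) * (1 - e) * (1 + 8 * e) = 1 + 6 * e - 15 * e ^+ 2 + 8 * e * e ^+ 2.
  by ring.
have : 0 <= 8 * e * e ^+ 2 by rewrite !mulr_ge0// ltW.
lra.
Qed.

Lemma ratio_lower (e C2 C4 a h x : R) : 0 < e -> e <= 1 / 8 -> 0 <= C2 ->
  0 < a -> 0 < x -> `|C4| + C2 * a <= e * x -> (1 - e) * x <= h + C4 ->
  1 - 8 * e <= ((1 - e) * (h / a) - C2) * (a / x).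
Proof.
move=> e0 e8 C20 a0 x0 Cx hx.
have -> : ((1 - e) * (h / a) - C2) * (a / x) = ((1 - e) * h - C2 * a) / x.
  by field; rewrite !gt_eqF.
rewrite ler_pdivlMr//.
have c4 : C4 <= `|C4| by exact: ler_norm.
have c40 : 0 <= `|C4| by [].
have Ca : 0 <= C2 * a by rewrite mulr_ge0// ltW.
have h1 : (1 - e) * ((1 - e) * x) <= (1 - e) * (h + `|C4|).
  by rewrite ler_pM2l; lra.
have ec : 0 <= e * `|C4| by rewrite mulr_ge0// ltW.
have ex : 0 <= x * e ^+ 2 by rewrite mulr_ge0 ?sqr_ge0// ltW.
have e0x : 0 <= e * x by rewrite mulr_ge0// ltW.
move: h1 ex; rewrite expr2; nra.
Qed.

End SqueezeRatio.


Theorem corollary2 (R : realType) (K M : nat) (d dE : measure_display)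
    (Omega : measurableType d) (E : measurableType dE)
    (lambda : {sigma_finite_measure set E -> \bar R}) (f g : E -> R)
    (I : \bar R) (N B : {set 'I_K}) (X : Omega -> obs_path K E)
    (Pinf : probability Omega R) (P : nat -> probability Omega R)
    (h : R -> R)
    (ltMK : (M < K)%N)
    (cardN : #|N| = (K - M)%N)
    (subBN : B \subset N)
    (densf : prob_density lambda f)
    (densg : prob_density lambda g)
    (defI : I = \int[lambda]_e (llr f g e * (g e)%:E))
    (I_gt0 : 0 < I)
    (I_fin : I < +oo)
    (measX : forall t k, (1 <= t)%N -> k \in N ->
       measurable_fun [set: Omega] (fun w => X w t k))
    (lawPinf : honest_law lambda N X (fun _ _ => f) Pinf)
    (lawP : forall nu : nat, honest_law lambda N X
       (fun t k => if (k \in B) && (nu < t)%N then g else f) (P nu)) :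
  let T gamma : obs_path K E -> \bar R :=
    low_sum_time f g [set: 'I_K]%SET (K - M) (h gamma) in
  let S gamma : obs_path K E -> \bar R :=
    low_sum_time f g N (K - M) (h gamma) in
  let calibrated : set R :=
    [set gamma : R | [/\ (1 <= gamma)%R, (0 < h gamma)%R &
                         \int[Pinf]_w S gamma (X w) = gamma%:E]] in
  (forall gamma, calibrated gamma -> admissible N X Pinf gamma (T gamma)) /\
  ((M + 1 <= #|B|)%N ->
   worst_delay N X P (T gamma) / ((ln gamma)%:E / ((#|B| - M)%:R%:E * I))
     @[gamma --> within calibrated (nbhs +oo%R)] --> 1).
Proof.
have I_fin_num : I \is a fin_num by rewrite gt0_fin_numE.
pose Ir := fine I.
have IE : I = Ir%:E by rewrite fineK.
have Ir0 : (0 < Ir)%R by rewrite -lte_fin -IE.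
have defIr : Ir%:E = \int[lambda]_e (llr f g e * (g e)%:E) by rewrite -IE.
move=> T S calibrated; split.
  move=> gamma [_ _ IS].
  exact: (low_sum_admissible densf densg measX cardN IS).
rewrite addn1 => MB.
have L0 : (0 < (#|B| - M)%:R :> R)%R by rewrite ltr0n subn_gt0.
pose a := ((#|B| - M)%:R * Ir)%R.
have a0 : (0 < a)%R by rewrite mulr_gt0.
apply: cvg_ereal_to1 => eta eta0.
(* [e] is small enough for the losses of all four bounds to add up to at most
   [8 * e <= eta]. *)
pose e := (Num.min eta 1 / 8)%R.
have e0 : (0 < e)%R by rewrite divr_gt0// lt_min eta0 ltr01.
have e8 : (e <= 1 / 8)%R by rewrite ler_pM2r ?invr_gt0// ge_min lexx orbT.
have e_eta : (8 * e <= eta)%R by rewrite /e mulrC divfK// ge_min lexx.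
have e1 : (e < 1)%R by lra.
have [C1 C10 delay_ub] :=
  worst_delay_upper densf densg measX ltMK cardN subBN lawP defIr Ir0 MB e0 e1.
have [C2 C20 delay_lb] :=
  worst_delay_lower densf densg measX ltMK cardN subBN lawP defIr Ir0 MB e0 e1.
have [C3 h_ub] :=
  calibrated_threshold_upper densf densg measX cardN lawPinf defIr Ir0 e0 e1.
have [C4 h_lb] :=
  calibrated_threshold_lower densf densg measX cardN subBN lawPinf lawP defIr Ir0 MB e0 e1.
pose x0 := (1 + (`|C3| + C1 * a) / e + (`|C4| + C2 * a) / e)%R.
exists (expR x0); split; first exact: num_real.
move=> gamma gx [g1 h0 IS].
have gamma0 : (0 < gamma)%R by lra.
pose x := ln gamma.
have xx0 : (x0 < x)%R by rewrite -[x0]expRK ltr_ln ?posrE ?expR_gt0.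
have p1 : (0 <= (`|C3| + C1 * a) / e)%R :=
  divr_ge0 (addr_ge0 (normr_ge0 _) (mulr_ge0 C10 (ltW a0))) (ltW e0).
have p2 : (0 <= (`|C4| + C2 * a) / e)%R :=
  divr_ge0 (addr_ge0 (normr_ge0 _) (mulr_ge0 C20 (ltW a0))) (ltW e0).
have x_gt0 : (0 < x)%R by move: xx0; rewrite /x0; lra.
have C13 : (C3 + C1 * a <= e * x)%R.
  apply: (@le_trans _ _ (`|C3| + C1 * a)%R); first by rewrite lerD2r ler_norm.
  by rewrite [leRHS]mulrC -ler_pdivrMr//; move: xx0; rewrite /x0; lra.
have C24 : (`|C4| + C2 * a <= e * x)%R.
  by rewrite [leRHS]mulrC -ler_pdivrMr//; move: xx0; rewrite /x0; lra.
have normalizer : ((ln gamma)%:E / ((#|B| - M)%:R%:E * I))^-1 = (a / x)%:E.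
  rewrite IE -EFinM -/a -/x inver (gt_eqF a0) -EFinM inver gt_eqF ?divr_gt0//.
  by rewrite invf_div.
have ax0 : 0 <= (a / x)%:E by rewrite lee_fin divr_ge0// ltW.
rewrite normalizer; apply/andP; split.
  apply: (le_trans _ (lee_wpmul2r ax0 (delay_lb _ h0))).
  rewrite -EFinM lee_fin (le_trans _ (ratio_lower e0 e8 C20 a0 x_gt0 C24 _))//.
    by rewrite lerD2l lerN2.
  exact: h_lb.
apply: (le_trans (lee_wpmul2r ax0 (delay_ub _ h0))).
rewrite -EFinM lee_fin (le_trans (ratio_upper e0 e8 C10 a0 x_gt0 C13 _))//.
  exact: h_ub.
by rewrite lerD2l.
Qed.
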